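(* Let $F(w)=\frac1n\sum_{i=1}^n F_i(w)$, where each $F_i:\mathbb{R}^d\to\mathbb{R}$ is smooth and convex, and let $w^*$ be the minimizer of $F$. Suppose that Assumptions A.1--A.4 listed in the context hold, with constants $\mu,L,M,\gamma,\sigma$ and $\kappa=L/\mu$. Let $\{w_k\}$ be the iterates generated by the Subsampled Newton-CG method (SSN-CG) described in the context, with $\alpha_k=1$, with $\|w_0-w^*\|\le\min\left\{\frac{\mu}{2M},\frac{\mu}{2\gamma M}\right\}$, with $$|T_k|=T\ge\frac{64\sigma^2}{\mu^2},$$ and with the number of CG steps performed at iteration $k$ equal to the smallest integer $r_k$ such that $$\left(\frac{\lambda^{T_k}_{d-r_k+1}-\lambda^{T_k}_1}{\lambda^{T_k}_{d-r_k+1}+\lambda^{T_k}_1}\right)\le\frac{1}{8\kappa^{3/2}},$$ where $0<\lambda_1^{T_k}\le\lambda_2^{T_k}\le\cdots\le\lambda_d^{T_k}$ are the eigenvalues of the subsampled Hessian $\nabla^2F_{T_k}(w_k)$. Then the total work required to get an $\epsilon$-accurate solution is $$\mathcal{O}\left(\left(n+\bar r\,\frac{\sigma^2}{\mu^2}\right)d\,\log\left(\frac1\epsilon\right)\right),\qquad\text{where } \bar r=\max_k r_k.$$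
   Context: **SSN-CG method.** Start from $w_0\in\mathbb{R}^d$. At iteration $k$, an index set $T_k\subset\{1,\dots,n\}$ is chosen, either uniformly at random (with or without replacement) or in a non-uniform manner, and the subsampled Hessian is defined as $$\nabla^2F_{T_k}(w_k)=\frac{1}{|T_k|}\sum_{i\in T_k}\nabla^2F_i(w_k).$$ The size $|T_k|=T$ is constant throughout the run, but the sample $T_k$ itself varies at every iteration. The search direction $p_k$ is the inexact solution obtained by running $r_k\le d$ iterations of the conjugate gradient (CG) method on the linear system $$\nabla^2F_{T_k}(w_k)\,p=-\nabla F(w_k),$$ where the gradient $\nabla F(w_k)$ is exact. The new iterate is $w_{k+1}=w_k+\alpha_kp_k$, where $\alpha_k$ is the steplength. **Assumptions.** A.1 (Bounded eigenvalues of Hessians) Each function $F_i$ is twice continuously differentiable and each component Hessian is positive definite with eigenvalues lying in a positive interval: there exist positive constants $\mu,L$ such that $\mu I\preceq\nabla^2F_i(w)\preceq LI$ for all $w\in\mathbb{R}^d$. Define $\kappa=L/\mu$. A.2 (Lipschitz continuity of Hessian) There is a constant $M>0$ such that $\|\nabla^2F(w)-\nabla^2F(z)\|\le M\|w-z\|$ for all $w,z\in\mathbb{R}^d$. A.3 (Bounded variance of Hessian components) There is a constant $\sigma$ such that, for all component Hessians, $\|\mathbb{E}[(\nabla^2F_i(w)-\nabla^2F(w))^2]\|\le\sigma^2$ for all $w\in\mathbb{R}^d$ (expectation over the random choice of the component index $i$). A.4 (Bounded moments of iterates) There is a constant $\gamma>0$ such that any iterate $w_k$ generated by the SSN-CG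 method satisfies $\mathbb{E}[\|w_k-w^*\|^2]\le\gamma\,(\mathbb{E}[\|w_k-w^*\|])^2$. **Notation.** $\|\cdot\|$ is the Euclidean norm for vectors and the induced (spectral) norm for matrices. In A.4, $\mathbb{E}$ denotes total expectation. **Work and accuracy.** The work is measured through the component gradient evaluations ($\nabla F_i$) and component Hessian-vector products ($\nabla^2F_i v$) needed to obtain an $\epsilon$-accurate solution; it is assumed that the cost of a product $\nabla^2F_i v$ is the same as the cost of evaluating a component gradient, and the factor $d$ in the bound accounts for this unit cost. An $\epsilon$-accurate solution is an iterate $w_k$ with $\mathbb{E}[\|w_k-w^*\|]\le\epsilon$.
   Formalization: Non-uniform sampling is taken as independent draws with weights under which the mean of the component Hessians equals the Hessian of F; the O-bound is as ε→0 for each problem, with a constant independent of the problem only when T is at most a fixed multiple of σ²/μ². *)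

(* Defs.v *)
(* Vectors of R^d are column vectors. *)
From mathcomp Require Import all_boot all_order all_algebra.
From mathcomp Require Import all_classical all_reals all_analysis.

Set Implicit Arguments.
Unset Strict Implicit.
Unset Printing Implicit Defensive.

Import Order.TTheory GRing.Theory Num.Theory.
Import numFieldNormedType.Exports.

Local Open Scope classical_set_scope.
Local Open Scope ring_scope.

Section Euclidean.
Context {R : realType}.

Definition dotp {d} (u v : 'cV[R]_d) : R := \sum_i u i 0 * v i 0.

(* The library norm `|v| on matrices is the sup norm, hence these two. *)
Definition enorm {d} (v : 'cV[R]_d) : R := Num.sqrt (dotp v v).

Definition opnorm {d} (A : 'M[R]_d) : R :=
  sup [set enorm (A *m v) | v in [set v : 'cV[R]_d | enorm v <= 1]].

Definition psd {d} (A : 'M[R]_d) : Prop :=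
  A^T = A /\ forall v : 'cV[R]_d, 0 <= dotp v (A *m v).

Definition loewner_le {d} (A B : 'M[R]_d) : Prop := psd (B - A).

(* s lists the eigenvalues of A with multiplicity, in nondecreasing order:
   lambda_j is s`_(j - 1). *)
Definition spectrum_of {d} (A : 'M[R]_d) (s : seq R) : Prop :=
  sorted <=%R s /\ char_poly A = \prod_(x <- s) ('X - x%:P).

End Euclidean.

Section Calculus.
Context {R : realType} {d : nat}.

Definition gradient (f : 'cV[R]_d -> R) (w : 'cV[R]_d) : 'cV[R]_d :=
  \col_i 'D_(delta_mx i 0) f w.

Definition hessian (f : 'cV[R]_d -> R) (w : 'cV[R]_d) : 'M[R]_d :=
  \matrix_(i, j) 'D_(delta_mx j 0) (fun z => 'D_(delta_mx i 0) f z) w.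

Definition twice_continuously_differentiable (f : 'cV[R]_d -> R) : Prop :=
  [/\ forall w, differentiable f w,
      forall w, differentiable (gradient f) w
    & continuous (hessian f)].

Definition convex_on_space (f : 'cV[R]_d -> R) : Prop :=
  @convex_function R 'cV[R]_d setT f.

End Calculus.

Section ConjugateGradient.
Context {R : realType} {d : nat}.

(* (iterate, residual, direction) of CG for A x = b, started at x = 0.
   Once the residual is 0 the conventions 0 / 0 = 0 make the iterate
   stationary, so running further steps returns the exact solution. *)
Definition cg_step (A : 'M[R]_d) (s : 'cV[R]_d * 'cV[R]_d * 'cV[R]_d) :
    'cV[R]_d * 'cV[R]_d * 'cV[R]_d :=
  let: (x, r, p) := s in
  let alpha := dotp r r / dotp p (A *m p) in
  let r' := r - alpha *: (A *m p) in
  let beta := dotp r' r' / dotp r r in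
  (x + alpha *: p, r', r' + beta *: p).

Definition cg (A : 'M[R]_d) (b : 'cV[R]_d) (m : nat) : 'cV[R]_d :=
  (iter m (cg_step A) (0, b, b)).1.1.

(* lambda_{d-r+1} and lambda_1 are lam`_(d - r) and lam`_0. *)
Definition cg_rate_ok (kappa : R) (lam : seq R) (r : nat) : Prop :=
  (lam`_(d - r) - lam`_0) / (lam`_(d - r) + lam`_0)
    <= 1 / (8 * kappa `^ (3 / 2)).

Definition smallest_cg_steps (kappa : R) (A : 'M[R]_d) (r : nat) : Prop :=
  exists2 lam : seq R, spectrum_of A lam &
    [/\ (1 <= r <= d)%N, cg_rate_ok kappa lam r
      & forall q : nat, (1 <= q <= d)%N -> cg_rate_ok kappa lam q ->
          (r <= q)%N].

End ConjugateGradient.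

Section FiniteSum.
Context {R : realType} {d n : nat}.
Implicit Types (F : 'I_n -> 'cV[R]_d -> R) (w : 'cV[R]_d).

Definition average F (w : 'cV[R]_d) : R := n%:R^-1 * \sum_i F i w.

(* A sample is a T-tuple of indices, so that repetitions are kept when
   sampling with replacement. *)
Definition subsampled_hessian F (T : nat) (t : T.-tuple 'I_n) w : 'M[R]_d :=
  T%:R^-1 *: \sum_(j < T) hessian (F (tnth t j)) w.

(* NonUniform pi: T independent draws with P(i) = pi w i, where the weights
   may depend on the current iterate w. *)
Variant sampling : Type :=
  | UniformWithReplacement
  | UniformWithoutReplacement
  | NonUniform of ('cV[R]_d -> 'I_n -> R).

Definition index_prob (s : sampling) w (i : 'I_n) : R :=
  if s is NonUniform pi then pi w i else n%:R^-1.

Definition sample_prob (s : sampling) (T : nat) w (t : T.-tuple 'I_n) : R :=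
  if s is UniformWithoutReplacement
  then if uniq t then (n ^_ T)%:R^-1 else 0
  else \prod_(j < T) index_prob s w (tnth t j).

(* The subsampled Hessian is an unweighted mean, so non-uniform weights have
   to be compatible with E[Hess F_i(w)] = Hess F(w); otherwise the sampling
   error is biased and does not decrease with T. *)
Definition admissible_sampling F (s : sampling) : Prop :=
  if s is NonUniform pi then
    forall w, [/\ forall i, 0 <= pi w i, \sum_i pi w i = 1
      & \sum_i pi w i *: hessian (F i) w = hessian (average F) w]
  else True.

Definition bounded_hessian_eigenvalues F (mu L : R) : Prop :=
  forall i, twice_continuously_differentiable (F i) /\
    forall w, loewner_le mu%:M (hessian (F i) w) /\
              loewner_le (hessian (F i) w) L%:M.

Definition lipschitz_hessian F (M : R) : Prop :=
  forall w z, opnorm (hessian (average F) w - hessian (average F) z)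
                <= M * enorm (w - z).

Definition bounded_hessian_variance F (s : sampling) (sigma : R) : Prop :=
  forall w,
    opnorm (\sum_i index_prob s w i *:
      ((hessian (F i) w - hessian (average F) w) *m
       (hessian (F i) w - hessian (average F) w))) <= sigma ^+ 2.

End FiniteSum.
Arguments sampling R d n : clear implicits.

Section Method.
Context {R : realType} {d n : nat}.
Context {dO : measure_display} {Omega : measurableType dO}.

(* Sampling T_k, number of CG steps r_k and iterates w_k of SSN-CG. The law
   clause says that sample_prob at w_k is the conditional law of T_k given
   T_0, ..., T_{k-1}: the conditioning event is the history of omega0. *)
Record ssn_cg (P : probability Omega R) (F : 'I_n -> 'cV[R]_d -> R)
    (T : nat) (s : sampling R d n) (alpha : nat -> R) (w0 : 'cV[R]_d)
    (Tk : nat -> Omega -> T.-tuple 'I_n) (r : nat -> Omega -> nat)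
    (w : nat -> Omega -> 'cV[R]_d) : Prop := SsnCg {
  ssn_cg_measurable : forall k t, measurable (Tk k @^-1` [set t]) ;
  ssn_cg_law : forall k t omega0,
    let history :=
      [set omega | forall j, (j < k)%N -> Tk j omega = Tk j omega0] in
    P (history `&` Tk k @^-1` [set t]) =
      ((sample_prob s (w k omega0) t)%:E * P history)%E ;
  ssn_cg_steps_le : forall k omega, (r k omega <= d)%N ;
  ssn_cg_init : forall omega, w 0 omega = w0 ;
  ssn_cg_iterate : forall k omega,
    w k.+1 omega = w k omega + alpha k *:
      cg (subsampled_hessian F (Tk k omega) (w k omega))
         (- gradient (average F) (w k omega)) (r k omega) }.

Definition expected_error (P : probability Omega R)
    (w : nat -> Omega -> 'cV[R]_d) (wstar : 'cV[R]_d) (k : nat) : \bar R :=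
  'E_P[fun omega => enorm (w k omega - wstar)]%E.

Definition bounded_moments (P : probability Omega R)
    (w : nat -> Omega -> 'cV[R]_d) (wstar : 'cV[R]_d) (gamma : R) : Prop :=
  forall k, ('E_P[fun omega => (enorm (w k omega - wstar) ^+ 2)%R]
               <= gamma%:E * expected_error P w wstar k ^+ 2)%E.

End Method.

(* Work of the first K iterations: iteration k evaluates n component gradients
   and, with r k CG steps, r k * T component Hessian-vector products; each
   evaluation costs d. *)
Definition total_work (n d T : nat) (r : nat -> nat) (K : nat) : nat :=
  (\sum_(k < K) (n + r k * T) * d)%N.

Definition is_max (r : nat -> nat) (m : nat) : Prop :=
  (forall k, (r k <= m)%N) /\ exists k, r k = m.

(* Main.v *)
Require Import Defs.
From mathcomp Require Import all_boot all_order all_algebra.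
From mathcomp Require Import all_classical all_reals all_analysis.
From mathcomp Require Import measurable_realfun ring lra.

Set Implicit Arguments.
Unset Strict Implicit.
Unset Printing Implicit Defensive.

Import Order.TTheory GRing.Theory Num.Theory.
Import numFieldNormedType.Exports.

Local Open Scope classical_set_scope.
Local Open Scope ring_scope.

(* One iteration contracts the mean error by 1/2. With A the subsampled Hessian,
   H the Hessian of F at w_k and e = w_k - w*, split
     w_{k+1} - w* = (e - A^-1 grad F(w_k)) + (p_k + A^-1 grad F(w_k)).
   The first term is at most
     (|(A - H) e| + |H e - grad F(w_k)|) / mu.
   Given the past, |(A - H) e| has mean at most sigma / sqrt T |e| <= mu / 8 |e|;
   |H e - grad F(w_k)| <= M / 2 |e|^2, which the moment assumption and the choice
   of w_0 turn into a contribution of 1/4 of the mean error. The second term is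
   the CG error: CG minimizes the A-norm error over the Krylov space, so any
   polynomial q of degree r_k with q(0) = 1 bounds it, and the rule defining r_k
   makes it at most |e| / 8. Everything random depends on finitely many samples,
   so expectations are finite sums over sample histories. *)

(** * Euclidean norm and quadratic forms *)

(** The exponent 3/2 in the CG rule pays for two estimates: passing from the [A]-norm to the
    Euclidean norm costs sqrt(kappa), and bounding the exact Newton step by the error, |A^-1 grad
    F(w_k)| <= kappa |e|, costs kappa. What remains of 1 / (8 kappa^(3/2)) is 1/8. The sampling
    term, the CG term and the quadratic term thus contribute 1/8 + 1/8 + 1/4. The law of T_k may
    depend on w_k, so averages over T_k are taken with the history fixed. This needs w_k to be a
    function of the earlier samples, hence r_k to be determined by the subsampled Hessian, which
    follows from uniqueness of its sorted spectrum. Eigenvectors come from the given factorization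
    of the characteristic polynomial, by Cayley-Hamilton. *)

Section EuclideanSpace.
Context {R : realType} {d : nat}.
Implicit Types (u v x y : 'cV[R]_d) (A B : 'M[R]_d) (a : R).

Lemma dotpE u v : dotp u v = (u^T *m v) 0 0.
Proof. by rewrite mxE; apply: eq_bigr => i _; rewrite mxE. Qed.

Lemma dotpC u v : dotp u v = dotp v u.
Proof. by apply: eq_bigr => i _; rewrite mulrC. Qed.

Lemma dotpDr u v y : dotp u (v + y) = dotp u v + dotp u y.
Proof. by rewrite !dotpE mulmxDr mxE. Qed.

Lemma dotpDl u v y : dotp (u + v) y = dotp u y + dotp v y.
Proof. by rewrite dotpC dotpDr !(dotpC y). Qed.

Lemma dotpZr a u v : dotp u (a *: v) = a * dotp u v.
Proof. by rewrite !dotpE -scalemxAr mxE. Qed.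

Lemma dotpZl a u v : dotp (a *: u) v = a * dotp u v.
Proof. by rewrite dotpC dotpZr dotpC. Qed.

Lemma dotpNr u v : dotp u (- v) = - dotp u v.
Proof. by rewrite -scaleN1r dotpZr mulN1r. Qed.

Lemma dotpNl u v : dotp (- u) v = - dotp u v.
Proof. by rewrite dotpC dotpNr dotpC. Qed.

Lemma dotpBr u v y : dotp u (v - y) = dotp u v - dotp u y.
Proof. by rewrite dotpDr dotpNr. Qed.

Lemma dotpBl u v y : dotp (u - v) y = dotp u y - dotp v y.
Proof. by rewrite dotpDl dotpNl. Qed.

Lemma dotp0r u : dotp u 0 = 0.
Proof. by rewrite -[0](scale0r u) dotpZr mul0r. Qed.

Lemma dotp0l u : dotp 0 u = 0.
Proof. by rewrite dotpC dotp0r. Qed.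

Definition dotpD := (dotpDl, dotpDr, dotpNl, dotpNr, dotpZl, dotpZr).

Lemma dotp_sumr I (s : seq I) (P : pred I) u (V : I -> 'cV[R]_d) :
  dotp u (\sum_(i <- s | P i) V i) = \sum_(i <- s | P i) dotp u (V i).
Proof. exact: (big_morph (dotp u) (dotpDr u) (dotp0r u)). Qed.

Lemma dotp_suml I (s : seq I) (P : pred I) u (V : I -> 'cV[R]_d) :
  dotp (\sum_(i <- s | P i) V i) u = \sum_(i <- s | P i) dotp (V i) u.
Proof. by rewrite dotpC dotp_sumr; apply: eq_bigr => i _; rewrite dotpC. Qed.

Lemma dotp_mulmx A u v : dotp u (A *m v) = dotp (A^T *m u) v.
Proof. by rewrite !dotpE trmx_mul trmxK mulmxA. Qed.

Lemma dotp_sym A u v : A^T = A -> dotp u (A *m v) = dotp (A *m u) v.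
Proof. by move=> sA; rewrite dotp_mulmx sA. Qed.

Lemma dotp_ge0 v : 0 <= dotp v v.
Proof. by apply: sumr_ge0 => i _; rewrite -expr2 sqr_ge0. Qed.

Lemma dotp_eq0 v : (dotp v v == 0) = (v == 0).
Proof.
apply/eqP/eqP => [/eqP|->]; last by rewrite dotp0r.
rewrite psumr_eq0 => [/allP v0|i _]; last by rewrite -expr2 sqr_ge0.
apply/colP => i; have := v0 i; rewrite mem_index_enum mxE => /(_ isT).
by rewrite mulf_eq0 orbb => /eqP.
Qed.

Lemma dotp_gt0 v : (0 < dotp v v) = (v != 0).
Proof. by rewrite lt0r dotp_ge0 andbT dotp_eq0. Qed.

Lemma enorm_ge0 v : 0 <= enorm v.
Proof. exact: sqrtr_ge0. Qed.

Lemma enorm_sqr v : enorm v ^+ 2 = dotp v v.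
Proof. by rewrite sqr_sqrtr ?dotp_ge0. Qed.

Lemma enorm0 : enorm (0 : 'cV[R]_d) = 0.
Proof. by rewrite /enorm dotp0r sqrtr0. Qed.

Lemma enorm_eq0 v : (enorm v == 0) = (v == 0).
Proof. by rewrite -sqrf_eq0 enorm_sqr dotp_eq0. Qed.

Lemma enormZ a v : enorm (a *: v) = `|a| * enorm v.
Proof.
rewrite /enorm dotpZl dotpZr mulrA -expr2 sqrtrM ?sqr_ge0 //.
by rewrite sqrtr_sqr.
Qed.

Lemma enormN v : enorm (- v) = enorm v.
Proof. by rewrite /enorm dotpNl dotpNr opprK. Qed.

Lemma enorm_le_sqr v a : 0 <= a -> dotp v v <= a ^+ 2 -> enorm v <= a.
Proof.
by move=> a0; rewrite -enorm_sqr ler_pXn2r // nnegrE // enorm_ge0.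
Qed.

(** The quadratic t -> <u + t v, A (u + t v)> is nonnegative. The form may be degenerate, so a
    vanishing leading coefficient is treated apart. *)
Lemma psd_cauchy_schwarz A u v : psd A ->
  dotp u (A *m v) ^+ 2 <= dotp u (A *m u) * dotp v (A *m v).
Proof.
move=> [sA pA].
set p := dotp u (A *m u); set q := dotp u (A *m v); set c := dotp v (A *m v).
have H t : 0 <= p + 2 * t * q + t ^+ 2 * c.
  have := pA (u + t *: v); rewrite mulmxDr -scalemxAr !dotpD.
  rewrite (dotp_sym v u sA) (dotpC (A *m v)) -/p -/q -/c.
  by congr (_ <= _); ring.
have p0 : 0 <= p := pA u.
have : 0 <= c := pA v.
rewrite le_eqVlt => /orP[/eqP c0|c0].
  rewrite -c0 mulr0; have [->|q0] := eqVneq q 0; first by rewrite expr0n.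
  (* With [c = 0] the quadratic is affine in t; if [q] were nonzero, this t would give it the value
     -1. *)
  have := H (- (p + 1) / (2 * q)); rewrite -c0 mulr0 addr0.
  have -> : p + 2 * (- (p + 1) / (2 * q)) * q = -1 by field.
  by rewrite oppr_ge0 ler10.
(* The minimizer of the quadratic. *)
have := H (- q / c).
have -> : p + 2 * (- q / c) * q + (- q / c) ^+ 2 * c = (p * c - q ^+ 2) / c.
  by field; rewrite gt_eqF.
by rewrite pmulr_lge0 ?invr_gt0 // subr_ge0.
Qed.

Lemma cauchy_schwarz u v : dotp u v <= enorm u * enorm v.
Proof.
have psd1 : psd (1%:M : 'M[R]_d).
  by split=> [|y]; rewrite ?trmx1 ?mul1mx ?dotp_ge0.
have := psd_cauchy_schwarz u v psd1; rewrite !mul1mx => H.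
apply: le_trans (ler_norm _) _.
rewrite -(@ler_pXn2r _ 2) ?nnegrE ?mulr_ge0 ?enorm_ge0 //.
by rewrite real_normK ?num_real // exprMn !enorm_sqr.
Qed.

Lemma enormD u v : enorm (u + v) <= enorm u + enorm v.
Proof.
apply: enorm_le_sqr; first by rewrite addr_ge0 ?enorm_ge0.
rewrite !dotpD (dotpC v u) -!enorm_sqr.
have := cauchy_schwarz u v; nra.
Qed.

Lemma enorm_sum I (s : seq I) (V : I -> 'cV[R]_d) :
  enorm (\sum_(i <- s) V i) <= \sum_(i <- s) enorm (V i).
Proof.
elim/big_ind2 : _ => [|a u b v le1 le2|//]; first by rewrite enorm0.
exact: le_trans (enormD _ _) (lerD le1 le2).
Qed.

(** A crude bound whose purpose is to show that the set defining [opnorm] is bounded above, so that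
    its [sup] is a genuine upper bound. *)
Lemma enorm_mulmx_bound A v :
  enorm (A *m v) <= (\sum_i enorm (row i A)^T) * enorm v.
Proof.
have -> : A *m v = \sum_i dotp (row i A)^T v *: delta_mx i 0.
  rewrite {1}[A *m v]matrix_sum_delta; apply: eq_bigr => i _.
  rewrite big_ord1; congr (_ *: _); rewrite mxE; apply: eq_bigr => j _.
  by rewrite !mxE.
apply: le_trans (enorm_sum _ _) _; rewrite mulr_suml.
apply: ler_sum => i _; rewrite enormZ.
have -> : enorm (delta_mx i 0 : 'cV[R]_d) = 1.
  rewrite /enorm /dotp (bigD1 i) //= big1 ?mxE ?eqxx ?mulr1 ?addr0 ?sqrtr1 //.
  by move=> j /negbTE ji; rewrite mxE ji mul0r.
rewrite mulr1 ler_norml cauchy_schwarz andbT lerNl -dotpNl.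
by rewrite -[enorm _^T]enormN cauchy_schwarz.
Qed.

Lemma enorm_mulmx A v : enorm (A *m v) <= opnorm A * enorm v.
Proof.
have [->|v0] := eqVneq v 0; first by rewrite mulmx0 enorm0 mulr0.
have ev0 : 0 < enorm v by rewrite lt0r enorm_eq0 v0 enorm_ge0.
rewrite -ler_pdivrMr //.
have -> : enorm (A *m v) / enorm v = enorm (A *m ((enorm v)^-1 *: v)).
  by rewrite -scalemxAr enormZ gtr0_norm ?invr_gt0 // mulrC.
apply: ub_le_sup.
  exists (\sum_i enorm (row i A)^T) => _ [x /= x1 <-].
  apply: le_trans (enorm_mulmx_bound _ _) _.
  by apply: ler_piMr => //; apply: sumr_ge0 => i _; exact: enorm_ge0.
exists ((enorm v)^-1 *: v) => //=.
by rewrite enormZ gtr0_norm ?invr_gt0 // mulVf ?gt_eqF.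
Qed.

Lemma loewner_le_scalarl a A v :
  loewner_le a%:M A -> a * dotp v v <= dotp v (A *m v).
Proof.
by move=> [_ /(_ v)]; rewrite mulmxBl mul_scalar_mx dotpBr dotpZr subr_ge0.
Qed.

Lemma loewner_le_scalarr a A v :
  loewner_le A a%:M -> dotp v (A *m v) <= a * dotp v v.
Proof.
by move=> [_ /(_ v)]; rewrite mulmxBl mul_scalar_mx dotpBr dotpZr subr_ge0.
Qed.

Lemma loewner_le_scalar_sym a A : loewner_le a%:M A -> A^T = A.
Proof.
by move=> [sA _]; rewrite -[A](subrK a%:M) linearD /= sA tr_scalar_mx.
Qed.

(** Cauchy-Schwarz for the form of [A], applied to x = A v and v, gives |x|^4 <= <x, A x> <v, A v>
    <= L |x|^2 L |v|^2; divide by |x|^2. *)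
Lemma enorm_loewner mu L A v : 0 <= mu ->
  loewner_le mu%:M A -> loewner_le A L%:M -> enorm (A *m v) <= L * enorm v.
Proof.
move=> mu0 lA uA; have sA := loewner_le_scalar_sym lA.
have pA : psd A.
  split=> // y; apply: le_trans (loewner_le_scalarl y lA).
  by rewrite mulr_ge0 ?dotp_ge0.
have [v0|v0] := eqVneq v 0; first by rewrite v0 mulmx0 enorm0 mulr0.
have L0 : 0 <= L.
  rewrite -(pmulr_lge0 _ (_ : 0 < dotp v v)) ?dotp_gt0 //.
  by apply: le_trans (loewner_le_scalarr v uA); apply: pA.2.
apply: enorm_le_sqr; first by rewrite mulr_ge0 ?enorm_ge0.
set x := A *m v.
have := psd_cauchy_schwarz x v pA; rewrite -/x => H.
have [->|x0] := eqVneq x 0; first by rewrite dotp0r sqr_ge0.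
have {}x0 : 0 < dotp x x by rewrite dotp_gt0.
have H1 : dotp x (A *m x) * dotp v x <= L * dotp x x * (L * dotp v v).
  by apply: ler_pM; [exact: pA.2|exact: pA.2|exact: loewner_le_scalarr..].
rewrite -(ler_pM2l x0) -expr2 exprMn enorm_sqr.
apply: le_trans H _; apply: le_trans H1 _.
by rewrite le_eqVlt (_ : _ == _) //; apply/eqP; ring.
Qed.

Lemma enorm_loewner_inv mu A v : 0 < mu ->
  loewner_le mu%:M A -> mu * enorm v <= enorm (A *m v).
Proof.
move=> mu0 lA.
have [v0|v0] := eqVneq v 0; first by rewrite v0 mulmx0 enorm0 mulr0.
have ev0 : 0 < enorm v by rewrite lt0r enorm_eq0 v0 enorm_ge0.
rewrite -(ler_pM2l ev0) mulrCA -expr2 enorm_sqr.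
exact: le_trans (loewner_le_scalarl v lA) (cauchy_schwarz _ _).
Qed.

(** By symmetry a row of the left kernel is, transposed, a vector killed by [A], and the lower bound
    mu |v| <= |A v| makes it zero. *)
Lemma loewner_le_unit mu A : 0 < mu -> loewner_le mu%:M A -> A \in unitmx.
Proof.
move=> mu0 lA; rewrite -row_full_unit -[row_full A]/(\rank A == d).
rewrite -/(row_free A) -kermx_eq0; apply/eqP/row_matrixP => i; rewrite row0.
set k := row i _; have kA : k *m A = 0.
  by apply/sub_kermxP; exact: row_sub.
have := enorm_loewner_inv k^T mu0 lA.
have -> : A *m k^T = 0.
  by rewrite -[A in A *m _](loewner_le_scalar_sym lA) -trmx_mul kA trmx0.
rewrite enorm0 pmulr_rle0 // => e0.
have : enorm k^T == 0 by rewrite eq_le e0 enorm_ge0.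
by rewrite enorm_eq0 trmx_eq0 => /eqP.
Qed.

End EuclideanSpace.

(** * Conjugate gradient *)

Section SpectralDecomposition.
Context {R : realType} {d : nat}.
Implicit Types (A : 'M[R]_d.+1) (u v : 'cV[R]_d.+1) (s : seq R) (q : {poly R}).

Lemma eigenvectors_orthogonal A u v (x y : R) : A^T = A ->
  A *m u = x *: u -> A *m v = y *: v -> x != y -> dotp u v = 0.
Proof.
move=> sA ux vy xy; have := dotp_sym u v sA.
rewrite ux vy dotpZl dotpZr => /eqP; rewrite -subr_eq0 -mulrBl mulf_eq0.
by rewrite subr_eq0 eq_sym (negbTE xy) => /eqP.
Qed.

Lemma horner_mx_prod_XsubC A s v :
  horner_mx A (\prod_(x <- s) ('X - x%:P)) *m v =
  foldl (fun u x => A *m u - x *: u) v s.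
Proof.
elim: s v => [|x s IH] v /=; first by rewrite big_nil rmorph1 mul1mx.
rewrite big_cons mulrC rmorphM /= -mulmxA -IH; congr (_ *m _).
by rewrite rmorphB /= horner_mx_X horner_mx_C mulmxBl mul_scalar_mx.
Qed.

(* Symmetry makes the annihilating polynomial squarefree: if (A - x) v has a
   component e in the x-eigenspace, then <e, e> = <e, (A - x) v> = 0. *)
Lemma eigen_decomposition A s v : A^T = A ->
  foldl (fun u x => A *m u - x *: u) v s = 0 ->
  exists2 e : R -> 'cV[R]_d.+1, forall x, A *m e x = x *: e x &
    v = \sum_(x <- undup s) e x.
Proof.
move=> sA; elim: s v => [|x s IH] v /=.
  move=> ->; exists (fun=> 0); last by rewrite big_nil.
  by move=> x; rewrite mulmx0 scaler0.
move=> /IH [e eE wE]; set w := A *m v - x *: v in wE.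
set s' := [seq y <- undup s | y != x].
have us' : uniq s' by rewrite filter_uniq ?undup_uniq.
have {}wE : w = \sum_(y <- s') e y.
  rewrite wE big_filter; have [xs|xs] := boolP (x \in s); last first.
    by rewrite [RHS]big_mkcond; apply: eq_big_seq => y;
      rewrite mem_undup; case: eqP => // ->; rewrite (negbTE xs).
  rewrite (bigD1_seq x) ?mem_undup ?undup_uniq //=.
  suff /eqP -> : e x == 0 by rewrite add0r.
  rewrite -dotp_eq0.
  have : dotp (e x) w = 0.
    by rewrite /w dotpBr dotp_sym // eE dotpZl dotpZr subrr.
  rewrite wE (bigD1_seq x) ?mem_undup ?undup_uniq //= dotpDr dotp_sumr.
  rewrite big1 ?addr0 => [->//|y yx].
  by apply: eigenvectors_orthogonal (eE x) (eE y) _ => //; rewrite eq_sym.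
(* On the y-eigenspace [A - x] acts as the nonzero scalar [y - x], so the subtracted sum is a
   preimage of [w] under [A - x]; hence [z] lies in the x-eigenspace. *)
set z := v - \sum_(y <- s') (y - x)^-1 *: e y.
exists (fun y => if y == x then z else (y - x)^-1 *: e y).
  move=> y; case: eqP => [->|_]; last by rewrite -scalemxAr eE !scalerA mulrC.
  have zE : A *m (\sum_(y <- s') (y - x)^-1 *: e y)
      - x *: (\sum_(y <- s') (y - x)^-1 *: e y) = w.
    rewrite wE mulmx_sumr scaler_sumr -sumrB.
    rewrite big_seq [RHS]big_seq; apply: eq_bigr => y'.
    rewrite mem_filter => /andP[y'x _].
    rewrite -scalemxAr eE !scalerA -scalerBl -[RHS]scale1r.
    by congr (_ *: _); field; rewrite subr_eq0.
  rewrite /z mulmxBr scalerBr -{1}[A *m v](subrK (x *: v)) -/w -zE.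
  by rewrite addrC !addrA addNr add0r addrC.
rewrite -[if _ then _ else _]/(undup (x :: s)).
have -> : \sum_(y <- undup (x :: s))
    (if y == x then z else (y - x)^-1 *: e y) =
  \sum_(y <- x :: s') (if y == x then z else (y - x)^-1 *: e y).
  apply: perm_big; apply: uniq_perm; rewrite ?undup_uniq //= ?us' ?andbT.
    by rewrite mem_filter eqxx.
  move=> y; rewrite !inE -/(undup (x :: s)) (mem_undup (x :: s)) inE.
  by rewrite mem_filter mem_undup; case: eqP.
rewrite big_cons eqxx big_filter.
rewrite (eq_bigr (fun y => (y - x)^-1 *: e y)); last first.
  by move=> y /negbTE ->.
by rewrite -big_filter subrK.
Qed.

Lemma spectral_decomposition A s v : A^T = A ->
  char_poly A = \prod_(x <- s) ('X - x%:P) ->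
  exists2 e : R -> 'cV[R]_d.+1, forall x, A *m e x = x *: e x &
    v = \sum_(x <- undup s) e x.
Proof.
move=> sA cA; apply: eigen_decomposition => //.
by rewrite -horner_mx_prod_XsubC -cA Cayley_Hamilton mul0mx.
Qed.

Lemma horner_mx_eigenvector A v x q :
  A *m v = x *: v -> horner_mx A q *m v = q.[x] *: v.
Proof.
move=> Av; elim/poly_ind: q => [|q c IH].
  by rewrite rmorph0 horner0 mul0mx scale0r.
rewrite rmorphD rmorphM /= horner_mx_X horner_mx_C mulmxDl -mulmxA Av.
by rewrite -scalemxAr IH mul_scalar_mx scalerA -scalerDl !hornerE mulrC.
Qed.

(** Along an expansion of [v] into orthogonal eigenvectors [e x], the energy is the sum of x |e
    x|^2, and applying q(A) multiplies each term by q(x)^2 <= rho^2. *)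
Lemma horner_mx_energy A s (rho : R) v q : A^T = A ->
  char_poly A = \prod_(x <- s) ('X - x%:P) ->
  {in s, forall x, 0 <= x} ->
  {in s, forall x, `|q.[x]| <= rho} ->
  dotp (horner_mx A q *m v) (A *m (horner_mx A q *m v)) <=
    rho ^+ 2 * dotp v (A *m v).
Proof.
move=> sA cA s0 qrho; have [e eE ->] := spectral_decomposition v sA cA.
have orth (f g : R -> R) :
    dotp (\sum_(x <- undup s) f x *: e x) (\sum_(x <- undup s) g x *: e x) =
    \sum_(x <- undup s) f x * g x * dotp (e x) (e x).
  rewrite dotp_suml; apply: eq_big_seq => x xs; rewrite dotp_sumr.
  rewrite (bigD1_seq x) ?undup_uniq //= big1 ?addr0; last first.
    move=> y yx; rewrite dotpZl dotpZr.
    rewrite (eigenvectors_orthogonal sA (eE x) (eE y)) ?mulr0 //.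
    by rewrite eq_sym.
  by rewrite dotpZl dotpZr mulrA.
have Ae (f : R -> R) : A *m (\sum_(x <- undup s) f x *: e x) =
    \sum_(x <- undup s) (x * f x) *: e x.
  rewrite mulmx_sumr; apply: eq_bigr => x _.
  by rewrite -scalemxAr eE scalerA mulrC.
have -> : horner_mx A q *m (\sum_(x <- undup s) e x) =
    \sum_(x <- undup s) q.[x] *: e x.
  by rewrite mulmx_sumr; apply: eq_bigr => x _; exact: horner_mx_eigenvector.
rewrite Ae orth.
have -> : \sum_(x <- undup s) e x = \sum_(x <- undup s) 1 *: e x.
  by apply: eq_bigr => x _; rewrite scale1r.
rewrite Ae orth mulr_sumr big_seq [leRHS]big_seq.
apply: ler_sum => x; rewrite mem_undup => xs.
have x0 := s0 x xs; have ee := dotp_ge0 (e x).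
rewrite mul1r mulr1 !mulrA ler_wpM2r //.
have -> : q.[x] * x * q.[x] = q.[x] ^+ 2 * x by ring.
rewrite ler_wpM2r // -real_normK ?num_real //.
by rewrite lerXn2r ?nnegrE ?normr_ge0 ?(le_trans _ (qrho x xs)) ?qrho.
Qed.

Lemma spectrum_size A s : spectrum_of A s -> size s = d.+1.
Proof.
move=> [_ cA]; have := size_char_poly A.
by rewrite cA size_prod_XsubC => -[].
Qed.

Lemma spectrum_unique A s s' : spectrum_of A s -> spectrum_of A s' -> s = s'.
Proof.
move=> [ss cs] [ss' cs']; apply: (sorted_eq le_trans le_anti) => //.
by apply: prod_XsubC_eq; rewrite -cs -cs'.
Qed.

Lemma spectrum_ge A s (mu : R) : loewner_le mu%:M A -> spectrum_of A s ->
  {in s, forall x, mu <= x}.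
Proof.
move=> lA [_ cA] x xs.
have : eigenvalue A x by rewrite eigenvalue_root_char cA root_prod_XsubC.
case/eigenvalueP => v vA v0.
have v0' : 0 < dotp v^T v^T by rewrite dotp_gt0 trmx_eq0.
have := loewner_le_scalarl v^T lA.
have -> : A *m v^T = x *: v^T.
  by rewrite -[A in LHS](loewner_le_scalar_sym lA) -trmx_mul vA linearZ.
by rewrite dotpZr ler_pM2r.
Qed.

End SpectralDecomposition.

(** * Krylov spaces *)

Section KrylovSpace.
Context {R : realType} {d : nat}.
Variables (A : 'M[R]_d.+1) (b : 'cV[R]_d.+1).
Implicit Types (u v x p : 'cV[R]_d.+1) (q : {poly R}).

(** The span of b, A b, ..., A^(k-1) b, encoded by polynomials of degree below [k] so that
    membership meets the polynomial bounds on the CG error directly. *)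
Definition krylov k v : Prop :=
  exists2 q : {poly R}, (size q <= k)%N & v = horner_mx A q *m b.

Lemma krylovD k u v : krylov k u -> krylov k v -> krylov k (u + v).
Proof.
move=> [q sq ->] [q' sq' ->]; exists (q + q').
  by rewrite (leq_trans (size_polyD _ _)) // geq_max sq.
by rewrite rmorphD /= mulmxDl.
Qed.

Lemma krylovZ k (a : R) v : krylov k v -> krylov k (a *: v).
Proof.
move=> [q sq ->]; exists (a *: q).
  exact: leq_trans (size_scale_leq _ _) sq.
by rewrite linearZ /= scalemxAl.
Qed.

Lemma krylovB k u v : krylov k u -> krylov k v -> krylov k (u - v).
Proof. by move=> Ku Kv; rewrite -scaleN1r; apply/krylovD/krylovZ. Qed.

Lemma krylovW k v : krylov k v -> krylov k.+1 v.
Proof. by move=> [q sq ->]; exists q => //; exact: leqW. Qed.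

Lemma krylov0 k : krylov k 0.
Proof. by exists 0; rewrite ?size_poly0 // rmorph0 mul0mx. Qed.

Lemma krylov_rhs k : krylov k.+1 b.
Proof. by exists 1; rewrite ?size_poly1 // rmorph1 mul1mx. Qed.

Lemma krylov_mulmx k v : krylov k v -> krylov k.+1 (A *m v).
Proof.
move=> [q sq ->]; exists ('X * q).
  have [->|q0] := eqVneq q 0; first by rewrite mulr0 size_poly0.
  by rewrite mulrC size_mulX.
by rewrite rmorphM /= horner_mx_X mulmxA.
Qed.

(** Each Krylov space has codimension at most one in the next, so [p] spans the quotient. The scalar
    is the ratio of the coefficients of X^k, which cancels the leading terms; that of [p] is nonzero
    because [p] is not in the smaller space. *)
Lemma krylov_split k p v : krylov k.+1 p -> ~ krylov k p -> krylov k.+1 v ->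
  exists a : R, krylov k (v - a *: p).
Proof.
move=> [q sq pE] nKp [q' sq' vE].
have qk : q`_k != 0.
  apply/eqP => qk; apply: nKp; exists q => //.
  apply/leq_sizeP => j; rewrite leq_eqVlt => /orP[/eqP <-//|kj].
  by move/leq_sizeP: sq; apply.
exists (q'`_k / q`_k); exists (q' - (q'`_k / q`_k) *: q).
  apply/leq_sizeP => j; rewrite coefB coefZ leq_eqVlt => /orP[/eqP <-|kj].
    by rewrite divfK // subrr.
  have -> : q`_j = 0 by apply: (leq_sizeP _ _ sq).
  have -> : q'`_j = 0 by apply: (leq_sizeP _ _ sq').
  by rewrite mulr0 subr0.
by rewrite pE vE rmorphB /= mulmxBl; congr (_ - _); rewrite linearZ /= scalemxAl.
Qed.

End KrylovSpace.

(** * Orthogonality and optimality of conjugate gradient *)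

Section ConjugateGradientTheory.
Context {R : realType} {d : nat}.
Variables (A : 'M[R]_d.+1) (b : 'cV[R]_d.+1).
Hypotheses (sA : A^T = A) (A_gt0 : forall v, v != 0 -> 0 < dotp v (A *m v)).
Implicit Types (u v x p : 'cV[R]_d.+1) (q : {poly R}).
Local Notation krylov := (krylov A b).

Let A_ge0 v : 0 <= dotp v (A *m v).
Proof.
by have [->|/A_gt0/ltW//] := eqVneq v 0; rewrite mulmx0 dotp0r.
Qed.

(** Orthogonality of the residual and conjugacy of the direction are stated against the whole Krylov
    space, so earlier residuals and directions need not be recorded. The last clause keeps [p]
    nonzero while the residual is nonzero. *)
Definition cg_invariant k (st : 'cV[R]_d.+1 * 'cV[R]_d.+1 * 'cV[R]_d.+1) :=
  let: (x, r, p) := st in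
  [/\ krylov k x, krylov k.+1 p, (forall v, krylov k v -> dotp r v = 0),
      (forall v, krylov k v -> dotp p (A *m v) = 0)
    & dotp p r = dotp r r].

(** A vector of the larger space is u + a p with u in the smaller one. The u part is settled by the
    old invariant or, for conjugacy, by orthogonality of [r'] to A u; [alpha] is chosen to settle
    the p part of orthogonality and [beta] that of conjugacy. *)
Lemma cg_step_invariant k x r p : r = b - A *m x -> r != 0 ->
  cg_invariant k (x, r, p) -> cg_invariant k.+1 (cg_step A (x, r, p)).
Proof.
move=> rE r0 [Kx Kp rK pK prr] /=.
have p0 : p != 0.
  by apply: contraNneq r0 => p0; rewrite -dotp_eq0 -prr p0 dotp0l.
have pAp := A_gt0 p0; have pAp0 := lt0r_neq0 pAp.
have rr0 : dotp r r != 0 by rewrite dotp_eq0.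
(* If [p] were in the k-th space it would be conjugate to itself, against <p, A p> > 0. *)
have nKp : ~ krylov k p by move=> /pK Hp; rewrite Hp eqxx in pAp0.
have Kr : krylov k.+1 r.
  by rewrite rE; apply: krylovB (krylov_rhs _ _ _) (krylov_mulmx _).
set alpha := dotp r r / dotp p (A *m p).
have alpha0 : alpha != 0 by rewrite mulf_neq0 ?invr_eq0.
set r' := r - alpha *: (A *m p); set beta := dotp r' r' / dotp r r.
have r'K v : krylov k.+1 v -> dotp r' v = 0.
  move=> /(krylov_split Kp nKp) [a Ku].
  rewrite -[v](subrK (a *: p)) dotpDr dotpZr {1}/r' dotpBl rK //.
  rewrite dotpZl -dotp_sym // pK // mulr0 subr0 add0r /r' dotpBl dotpZl.
  rewrite (dotpC r p) prr (dotpC (A *m p)) /alpha divfK //.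
  by rewrite subrr mulr0.
(* A p is a multiple of r - r', and [r] lies in the space to which [r'] is now orthogonal. *)
have r'Ap : dotp r' (A *m p) = - (dotp r' r' / alpha).
  have -> : A *m p = alpha^-1 *: (r - r').
    by rewrite /r' opprB addrC subrK scalerA mulVf ?scale1r.
  by rewrite dotpZr dotpBr r'K // sub0r mulrC mulNr.
split.
- by apply: krylovD; [exact: krylovW|exact: krylovZ].
- apply: krylovD; last exact/krylovW/krylovZ.
  by apply: krylovB; [exact: krylovW|exact/krylovZ/krylov_mulmx].
- exact: r'K.
- move=> v /(krylov_split Kp nKp) [a Ku].
  rewrite -[v](subrK (a *: p)) mulmxDr dotpDr.
  rewrite dotpDl dotpZl (pK _ Ku) mulr0 addr0 (r'K _ (krylov_mulmx Ku)) add0r.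
  rewrite -scalemxAr dotpZr dotpDl dotpZl r'Ap.
  rewrite /beta /alpha; set t := dotp r' r'.
  apply/eqP; rewrite mulf_eq0; apply/orP; right; apply/eqP; field.
  by rewrite rr0 pAp0.
- by rewrite dotpDl dotpZl (dotpC p) (r'K p Kp) mulr0 addr0.
Qed.

(** The alternative of a zero residual records early convergence: it forces [alpha = 0], so the
    residual stays zero although the invariant is no longer maintained. *)
Lemma cg_state_spec k : let st := iter k (cg_step A) (0, b, b) in
  st.1.2 = b - A *m st.1.1 /\ (st.1.2 = 0 \/ cg_invariant k st).
Proof.
elim: k => [|k] /=.
  split; first by rewrite mulmx0 subr0.
  right; split=> //; [exact: krylov0|exact: krylov_rhs|..];
    by move=> v [q]; rewrite leqn0 size_poly_eq0 => /eqP -> ->;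
    rewrite rmorph0 mul0mx ?mulmx0 dotp0r.
case: (iter _ _ _) => -[x r] p /= [rE inv]; split.
  by rewrite {1}rE mulmxDr opprD addrA scalemxAr.
have [r0|r0] := eqVneq r 0.
  by left; rewrite r0 dotp0r mul0r scale0r subr0.
case: inv => [/eqP|inv]; first by rewrite (negbTE r0).
by right; exact: cg_step_invariant.
Qed.

(** Since q(0) = 1, write q = 1 - h X; then q(A) x = x - h(A) b is the error of another Krylov
    candidate. It differs from the CG error e by a Krylov vector z orthogonal to the residual A e,
    so the energy of e - z is that of e plus that of z. *)
Lemma cg_optimal k q x : A *m x = b -> (size q <= k.+1)%N -> q.[0] = 1 ->
  dotp (x - cg A b k) (A *m (x - cg A b k)) <=
  dotp (horner_mx A q *m x) (A *m (horner_mx A q *m x)).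
Proof.
move=> Ax sq q0; have := cg_state_spec k; rewrite /cg.
case: (iter _ _ _) => -[xk r] p /= [rE inv].
have AeE : A *m (x - xk) = r by rewrite mulmxBr Ax.
case: inv => [r0|[Kx _ rK _ _]]; first by rewrite AeE r0 dotp0r.
have : root (1 - q) 0 by rewrite rootE !hornerE q0 subrr.
case/factor_theorem => h; rewrite subr0 => hE.
have sh : (size h <= k)%N.
  have [->|h0] := eqVneq h 0; first by rewrite size_poly0.
  rewrite -ltnS -(size_mulX h0) -hE (leq_trans (size_polyD _ _)) //.
  by rewrite size_polyN size_poly1 geq_max sq.
have -> : q = 1 - h * 'X by rewrite -hE opprB addrC subrK.
rewrite rmorphB rmorphM rmorph1 /= horner_mx_X mulmxBl mul1mx -mulmxA Ax.
set z := horner_mx A h *m b - xk.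
have Kz : krylov k z by apply: krylovB => //; exists h.
have -> : x - horner_mx A h *m b = (x - xk) - z.
  by rewrite /z opprB addrA subrK.
move: AeE; set e := x - xk => AeE; clearbody z e.
rewrite AeE mulmxBr AeE dotpBr !dotpBl (dotpC z r) (rK z Kz) subr0.
rewrite dotp_sym // AeE (rK z Kz) sub0r opprK lerDl.
exact: A_ge0.
Qed.

End ConjugateGradientTheory.

(** * The CG rate in terms of the spectrum *)

Section ConjugateGradientRate.
Context {R : realType}.

(* Witness: one root at the midpoint of [lambda_1, lambda_{d-r+1}] and one at
   each of the r - 1 larger eigenvalues. *)
Lemma cg_rate_polynomial (lam : seq R) (r : nat) :
  sorted <=%R lam -> {in lam, forall x, 0 < x} -> (1 <= r <= size lam)%N ->
  let c := lam`_(size lam - r) in let a := lam`_0 in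
  exists q : {poly R}, [/\ (size q <= r.+1)%N, q.[0] = 1, 0 <= (c - a) / (c + a)
    & {in lam, forall x, `|q.[x]| <= (c - a) / (c + a)}].
Proof.
(* [m] is the 0-based position of lambda_{d-r+1}, so [drop m.+1 lam] lists the r - 1 entries after
   it. *)
move=> slam lam0 /andP[r1 rs] c a; set m := (size lam - r)%N in c *.
have ms : (m < size lam)%N by rewrite ltn_subrL r1 (leq_trans r1 rs).
have nth_le i j : (i <= j < size lam)%N -> lam`_i <= lam`_j.
  move=> /andP[ij js]; apply: (sorted_leq_nth le_trans lexx) => //.
  by rewrite inE (leq_ltn_trans ij).
have a0 : 0 < a by apply/lam0/mem_nth/(leq_ltn_trans _ ms).
have ac : a <= c by apply: nth_le.
have ca0 : 0 < c + a by rewrite addr_gt0 // (lt_le_trans a0).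
have rho0 : 0 <= (c - a) / (c + a) by rewrite divr_ge0 ?subr_ge0 ?(ltW ca0).
pose g := \prod_(y <- drop m.+1 lam) (1 - y^-1 *: 'X) : {poly R}.
have gE x : g.[x] = \prod_(y <- drop m.+1 lam) (1 - y^-1 * x).
  by rewrite horner_prod; apply: eq_bigr => y _; rewrite !hornerE.
have sfactor (e : R) : (size (1 - e *: 'X : {poly R})%R <= 2)%N.
  rewrite (leq_trans (size_polyD _ _)) // geq_max size_poly1 size_polyN /=.
  by rewrite (leq_trans (size_scale_leq _ _)) ?size_polyX.
have sg : (size g <= r)%N.
  rewrite -[r](subKn rs) -/m -(prednK (_ : 0 < size lam - m)%N) ?subn_gt0 //.
  rewrite -subnS -size_drop /g; elim: (drop _ _) => [|y t IH].
    by rewrite big_nil size_poly1.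
  rewrite big_cons (leq_trans (size_polyMleq _ _)) // -subn1 leq_subLR.
  exact: leq_add (sfactor _) IH.
exists ((1 - (2 / (c + a)) *: 'X) * g); split=> //.
- rewrite (leq_trans (size_polyMleq _ _)) //.
  by rewrite -subn1 leq_subLR; exact: leq_add (sfactor _) sg.
- by rewrite hornerM gE !hornerE subr0 mul1r big1 // => y _;
    rewrite mulr0 subr0.
move=> _ /(nthP 0)[i ilam <-]; rewrite hornerM gE normrM.
have [im|mi] := leqP i m; last first.
  suff -> : \prod_(y <- drop m.+1 lam) (1 - y^-1 * lam`_i) = 0.
    by rewrite normr0 mulr0.
  apply/eqP; rewrite prodf_seq_eq0; apply/hasP; exists lam`_i => /=.
    rewrite -(subnKC mi) -nth_drop mem_nth // size_drop ltn_sub2r //.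
    exact: leq_ltn_trans mi ilam.
  by rewrite mulVf ?subrr // gt_eqF // lam0 // mem_nth.
have ai : a <= lam`_i by apply: nth_le.
have ic : lam`_i <= c by apply: nth_le; rewrite im.
(* For lambda_i in [a, c] the midpoint factor is (c + a - 2 lambda_i) / (c + a), of modulus at most
   (c - a) / (c + a). Each factor of [g] is 1 - lambda_i / y with y >= lambda_i, hence in [0, 1]. *)
rewrite -[leRHS]mulr1; apply: ler_pM => //.
  rewrite !hornerE.
  have -> : 1 - 2 / (c + a) * lam`_i = (c + a - 2 * lam`_i) / (c + a).
    by field; rewrite gt_eqF.
  rewrite normrM normfV (gtr0_norm ca0) ler_pM2r ?invr_gt0 //.
  by rewrite ler_norml; apply/andP; split; lra.
rewrite normr_prod big_seq; apply: prodr_ile1 => y yt; rewrite normr_ge0 /=.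
have [j jt <-] := nthP 0 yt.
move: jt; rewrite size_drop => jt.
rewrite nth_drop; set l := (m.+1 + j)%N.
have ls : (l < size lam)%N by rewrite /l -ltn_subRL.
have l0 : 0 < lam`_l by apply/lam0/mem_nth.
have il : lam`_i <= lam`_l.
  by apply: nth_le; rewrite ls andbT (leq_trans im) // /l addSnnS leq_addr.
have i0 : 0 < lam`_i := lt_le_trans a0 ai.
rewrite mulrC ger0_norm ?subr_ge0 ?ler_pdivrMr ?mul1r //.
by rewrite gerBl divr_ge0 // ltW.
Qed.

(** mu |e|^2 <= <e, A e> <= rho^2 <x, A x> <= rho^2 L |x|^2 with rho <= 1 / (8 kappa^(3/2)), so |e|
    <= sqrt(kappa) rho |x| <= |x| / (8 kappa). Working with squares turns the fractional power into
    kappa^3. *)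
Lemma cg_error d (A : 'M[R]_d.+1) (b x : 'cV[R]_d.+1) (mu L : R) lam r :
  0 < mu -> 0 < L -> loewner_le mu%:M A -> loewner_le A L%:M ->
  spectrum_of A lam -> (1 <= r <= d.+1)%N -> @cg_rate_ok R d.+1 (L / mu) lam r ->
  A *m x = b -> enorm (cg A b r - x) <= mu / (8 * L) * enorm x.
Proof.
move=> mu0 L0 lA uA slam r1 rate Ax.
have sA := loewner_le_scalar_sym lA.
have Agt0 v : v != 0 -> 0 < dotp v (A *m v).
  move=> v0; apply: lt_le_trans (loewner_le_scalarl v lA).
  by rewrite mulr_gt0 ?dotp_gt0.
have lam_gt0 : {in lam, forall y, 0 < y}.
  by move=> y ylam; exact: lt_le_trans (spectrum_ge lA slam ylam).
have ssize := spectrum_size slam.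
have := cg_rate_polynomial slam.1 lam_gt0; rewrite ssize => /(_ r r1) /=.
move: rate; rewrite /cg_rate_ok; set rho := (_ - _) / _ => rate.
move=> [q [sq q0 rho0 qlam]].
have opt := cg_optimal sA Agt0 Ax sq q0.
have en := horner_mx_energy x sA slam.2 (fun y ylam => ltW (lam_gt0 y ylam)) qlam.
rewrite -enormN opprB; set e := x - _ in opt *.
have k0 : 0 < L / mu by rewrite divr_gt0.
have kE : (8 * (L / mu) `^ (3 / 2)) ^+ 2 = 64 * (L / mu) ^+ 3.
  rewrite exprMn -[_ `^ _ ^+ 2]powR_mulrn ?powR_ge0 // -powRrM divfK //.
  by rewrite powR_mulrn ?ltW //; congr (_ * _); ring.
have rho2 : rho ^+ 2 <= (64 * (L / mu) ^+ 3)^-1.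
  rewrite -kE -exprVn -[_^-1]div1r.
  by rewrite ler_pXn2r ?nnegrE // (le_trans rho0).
apply: enorm_le_sqr.
  by rewrite mulr_ge0 ?enorm_ge0 // divr_ge0 ?ltW // mulr_gt0.
rewrite exprMn enorm_sqr -(ler_pM2l mu0).
apply: le_trans (loewner_le_scalarl e lA) _.
apply: le_trans (le_trans opt en) _.
apply: (@le_trans _ _ ((64 * (L / mu) ^+ 3)^-1 * (L * dotp x x))).
  apply: ler_pM => //; first exact: sqr_ge0.
    by have [->|/Agt0/ltW//] := eqVneq x 0; rewrite dotp0l.
  exact: loewner_le_scalarr x uA.
rewrite le_eqVlt (_ : _ == _) //; apply/eqP; field.
by rewrite !gt_eqF.
Qed.

End ConjugateGradientRate.

(** * Gradients and Hessians *)

Section DerivativesAlongLines.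
Context {R : realType} {d : nat}.
Implicit Types (f g : 'cV[R]_d -> R) (u v w z : 'cV[R]_d) (t : R).

Lemma is_derive_line f z v t : differentiable f (z + t *: v) ->
  is_derive t 1 (fun x => f (z + x *: v)) ('D_v f (z + t *: v)).
Proof.
move=> df; have lineE : (fun h : R => h^-1 *:
    (f (z + (h *: (1 : R) + t) *: v) - f (z + t *: v))) =
    (fun h : R => h^-1 *: (f (h *: v + (z + t *: v)) - f (z + t *: v))).
  apply/funext => h; congr (_ *: (f _ - _)).
  by rewrite scalerDl addrCA [h *: 1]mulr1.
by split; [rewrite /derivable lineE; exact: diff_derivable|
  rewrite /derive lineE].
Qed.

Lemma derive_partial f z v : differentiable f z ->
  'D_v f z = \sum_i v i 0 * 'D_(delta_mx i 0) f z.
Proof.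
move=> df; rewrite deriveE //.
have -> : 'd f z v = 'd f z (\sum_i v i 0 *: delta_mx i 0).
  congr ('d f z _); rewrite {1}[v]matrix_sum_delta.
  by apply: eq_bigr => i _; rewrite big_ord1.
rewrite linear_sum; apply: eq_bigr => i _.
by rewrite linearZ deriveE.
Qed.

Lemma differentiable_partial f z i : differentiable (gradient f) z ->
  differentiable (fun x => 'D_(delta_mx i 0) f x) z.
Proof.
move=> df.
have -> : (fun x => 'D_(delta_mx i 0) f x) =
    (fun N : 'cV[R]_d => N i 0 : R) \o gradient f.
  by apply/funext => x; rewrite /= mxE.
by apply: differentiable_comp => //; exact: differentiable_coord.
Qed.

Lemma dotp_gradientE f u :
  (fun x => dotp u (gradient f x)) =
  \sum_i (u i 0 *: (fun x => 'D_(delta_mx i 0) f x)).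
Proof.
apply/funext => x; rewrite fct_sumE; apply: eq_bigr => i _.
by rewrite mxE.
Qed.

Lemma differentiable_dotp_gradient f u z : differentiable (gradient f) z ->
  differentiable (fun x => dotp u (gradient f x)) z.
Proof.
move=> df; rewrite dotp_gradientE; apply: differentiable_sum => i.
exact/differentiableZ/differentiable_partial.
Qed.

Lemma derive_dotp_gradient f u v z : differentiable (gradient f) z ->
  'D_v (fun x => dotp u (gradient f x)) z = dotp u (hessian f z *m v).
Proof.
move=> df; rewrite dotp_gradientE derive_sum => [|i]; last first.
  exact/diff_derivable/differentiableZ/differentiable_partial.
apply: eq_bigr => i _; rewrite deriveZ; last first.
  exact/diff_derivable/differentiable_partial.
congr (_ * _); rewrite derive_partial; last exact: differentiable_partial.
by rewrite mxE; apply: eq_bigr => j _; rewrite mxE mulrC.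
Qed.

Lemma is_derive_dotp_gradient_line f u z v t :
  differentiable (gradient f) (z + t *: v) ->
  is_derive t 1 (fun x => dotp u (gradient f (z + x *: v)))
    (dotp u (hessian f (z + t *: v) *m v)).
Proof.
move=> df; have dg := differentiable_dotp_gradient u df.
have := is_derive_line dg; by rewrite (derive_dotp_gradient u v df).
Qed.

(** Replaces integration of the Hessian along a segment: the vector estimates below are tested
    against the very vector to be bounded, which leaves a scalar monotonicity statement. *)
Lemma le_unit_interval (h dh : R -> R) :
  (forall t, is_derive t 1 h (dh t)) ->
  (forall t, 0 < t < 1 -> dh t <= 0) -> h 1 <= h 0.
Proof.
move=> dhE dh0; apply: (@ler0_derive1_le_cc R h 0 1) => //.
- by move=> x; rewrite in_itv /= => x01; rewrite derive1E derive_val dh0.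
- by apply: derivable_within_continuous => x _.
- by rewrite in_itv /= lexx ler01.
- by rewrite in_itv /= lexx ler01.
Qed.

Lemma gradient_minimizer f w :
  (forall z, differentiable f z) -> (forall z, f w <= f z) -> gradient f w = 0.
Proof.
move=> df fw; apply/colP => i; rewrite !mxE.
have line t := is_derive_line (df (w + t *: delta_mx i 0)).
have := @derive1_at_min R (fun t => f (w + t *: delta_mx i 0)) (-1) 1 0.
have le11 : -1 <= 1 :> R by lra.
move=> /(_ le11); case; [by move=> t _; case: (line t)| |
  by move=> t _; rewrite scale0r addr0|].
  by rewrite in_itv /= ltrN10 ltr01.
move=> _; have [_ ->] := line 0.
by rewrite scale0r addr0.
Qed.

(** With u the difference of gradients, <u, grad f(z + t e)> - t L |u| |e| is nonincreasing in t;
    comparing t = 0 and t = 1 gives |u|^2 <= L |u| |e|. *)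
Lemma gradient_lipschitz f (mu L : R) w z : 0 <= mu ->
  (forall x, differentiable (gradient f) x) ->
  (forall x, loewner_le mu%:M (hessian f x)) ->
  (forall x, loewner_le (hessian f x) L%:M) ->
  enorm (gradient f w - gradient f z) <= L * enorm (w - z).
Proof.
move=> mu0 df lH uH; set u := gradient f w - gradient f z.
set e := w - z.
have [u0|u0] := leP (enorm u) 0.
  apply: le_trans u0 _; apply: le_trans (enorm_ge0 (hessian f w *m e)) _.
  exact: enorm_loewner mu0 (lH w) (uH w).
pose h t := dotp u (gradient f (z + t *: e)) - t * (L * enorm u * enorm e).
pose dh t := dotp u (hessian f (z + t *: e) *m e) - L * enorm u * enorm e.
have hdh t : is_derive t 1 h (dh t).
  apply: is_deriveB; first exact: is_derive_dotp_gradient_line.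
  by apply: is_derive_eq; rewrite /GRing.scale /=; ring.
have dh0 t : 0 < t < 1 -> dh t <= 0.
  move=> _; rewrite subr_le0; apply: le_trans (cauchy_schwarz _ _) _.
  rewrite -mulrA mulrCA ler_pM2l //; exact: enorm_loewner mu0 (lH _) (uH _).
have := le_unit_interval hdh dh0; rewrite /h.
rewrite scale1r scale0r addr0 [z + e]addrC subrK mul1r mul0r subr0.
rewrite lerBlDr -lerBlDl -dotpBr -/u -enorm_sqr.
by rewrite mulrAC expr2 ler_pM2r.
Qed.

Lemma gradient_taylor f (M : R) w z : 0 <= M ->
  (forall x, differentiable (gradient f) x) ->
  (forall x y, opnorm (hessian f x - hessian f y) <= M * enorm (x - y)) ->
  enorm (hessian f w *m (w - z) - (gradient f w - gradient f z)) <=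
    M / 2 * enorm (w - z) ^+ 2.
Proof.
move=> M0 df lipH; set e := w - z; set u := _ - _.
have [u0|u0] := leP (enorm u) 0.
  by apply: le_trans u0 _; rewrite mulr_ge0 ?divr_ge0 ?sqr_ge0.
set K := M * enorm e ^+ 2 * enorm u.
(* The point z + t e is at distance (1 - t) |e| from [w], so the Hessian difference contributes at
   most K (1 - t); the last term is chosen with derivative - K (1 - t), and its value K / 2 at 0 is
   the source of M / 2. *)
pose h t := t * dotp u (hessian f w *m e) - dotp u (gradient f (z + t *: e))
     + K / 2 * (1 - t) ^+ 2.
pose dh t := dotp u (hessian f w *m e) - dotp u (hessian f (z + t *: e) *m e)
     - K * (1 - t).
have hdh t : is_derive t 1 h (dh t).
  apply: is_deriveD; first apply: is_deriveB.
  - by apply: is_derive_eq; rewrite /GRing.scale /=; ring.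
  - exact: is_derive_dotp_gradient_line.
  - by apply: is_derive_eq; rewrite /GRing.scale /= add0r !mulrN1; lra.
have dh0 t : 0 < t < 1 -> dh t <= 0.
  move=> /andP[t0 t1].
  rewrite /dh -dotpBr -mulmxBl subr_le0; apply: le_trans (cauchy_schwarz _ _) _.
  rewrite /K mulrC mulrAC ler_pM2r //; apply: le_trans (enorm_mulmx _ _) _.
  apply: le_trans (ler_wpM2r (enorm_ge0 _) (lipH _ _)) _.
  have -> : w - (z + t *: e) = (1 - t) *: e.
    by rewrite opprD addrA -/e scalerBl scale1r.
  rewrite enormZ ger0_norm ?subr_ge0 ?(ltW t1) //.
  by rewrite le_eqVlt (_ : _ == _) //; apply/eqP; ring.
have := le_unit_interval hdh dh0; rewrite /h.
rewrite scale1r scale0r addr0 [z + e]addrC subrK mul1r mul0r sub0r.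
rewrite subrr expr0n mulr0 addr0 subr0 expr1n mulr1 addrC -lerBrDr => H.
have : enorm u * enorm u <= M / 2 * enorm e ^+ 2 * enorm u.
  rewrite -expr2 enorm_sqr {2}/u !dotpBr.
  by move: H; rewrite /K; lra.
by rewrite ler_pM2r.
Qed.

End DerivativesAlongLines.

Section Average.
Context {R : realType} {d n : nat}.
Variable F : 'I_n -> 'cV[R]_d -> R.
Hypotheses (dF : forall i w, differentiable (F i) w)
  (dgF : forall i w, differentiable (gradient (F i)) w).

Let averageE : average F = n%:R^-1 *: \sum_(i < n) F i.
Proof. by apply/funext => w; rewrite /average /= fct_sumE. Qed.

Lemma differentiable_average w : differentiable (average F) w.
Proof. by rewrite averageE; exact/differentiableZ/differentiable_sum. Qed.

Lemma derive_average v :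
  (fun w => 'D_v (average F) w) = n%:R^-1 *: \sum_(i < n) (fun w => 'D_v (F i) w).
Proof.
apply/funext => w; rewrite averageE deriveZ; last first.
  exact/diff_derivable/differentiable_sum.
rewrite derive_sum /= ?fct_sumE // => i; exact: diff_derivable.
Qed.

Lemma gradient_average :
  gradient (average F) = n%:R^-1 *: \sum_(i < n) gradient (F i).
Proof.
apply/funext => w; apply/colP => j; rewrite mxE.
rewrite -[LHS]/((fun w => 'D_(delta_mx j 0) (average F) w) w) derive_average.
by rewrite /= !fct_sumE !mxE summxE; congr (_ * _); apply: eq_bigr => i _;
  rewrite mxE.
Qed.

Lemma differentiable_gradient_average w :
  differentiable (gradient (average F)) w.
Proof.
by rewrite gradient_average; exact/differentiableZ/differentiable_sum.
Qed.

Lemma hessian_average w :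
  hessian (average F) w = n%:R^-1 *: \sum_(i < n) hessian (F i) w.
Proof.
apply/matrixP => i j; rewrite !mxE derive_average deriveZ; last first.
  by apply/diff_derivable/differentiable_sum => k; exact: differentiable_partial.
rewrite derive_sum => [|k]; last exact/diff_derivable/differentiable_partial.
by rewrite summxE; congr (_ * _); apply: eq_bigr => k _; rewrite mxE.
Qed.

End Average.

Section LoewnerMean.
Context {R : realType} {d : nat}.

(** Serves both the full Hessian, a mean over the components, and the subsampled one, a mean over
    the draws. *)
Lemma loewner_le_mean n (a : R) (A : 'I_n -> 'M[R]_d) : (0 < n)%N ->
  (forall i, loewner_le a%:M (A i)) ->
  loewner_le a%:M (n%:R^-1 *: \sum_i A i).
Proof.
move=> n0 lA; have nR : n%:R != 0 :> R by rewrite pnatr_eq0 -lt0n.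
rewrite /loewner_le.
have -> : n%:R^-1 *: \sum_i A i - a%:M = n%:R^-1 *: \sum_i (A i - a%:M).
  rewrite sumrB scalerBr sumr_const card_ord -[_%:M *+ _]scaler_nat scalerA.
  by rewrite mulVf // scale1r.
split; first by rewrite linearZ /= linear_sum; congr (_ *: _);
  apply: eq_bigr => i _; have [] := lA i.
move=> v; rewrite -scalemxAl dotpZr mulr_ge0 ?invr_ge0 ?ler0n //.
by rewrite mulmx_suml dotp_sumr sumr_ge0 // => i _; have [_] := lA i.
Qed.

Lemma loewner_ge_mean n (a : R) (A : 'I_n -> 'M[R]_d) : (0 < n)%N ->
  (forall i, loewner_le (A i) a%:M) ->
  loewner_le (n%:R^-1 *: \sum_i A i) a%:M.
Proof.
move=> n0 uA; have aE : (- a)%:M = - a%:M :> 'M[R]_d by rewrite raddfN.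
rewrite /loewner_le; have -> : a%:M - n%:R^-1 *: \sum_i A i =
    n%:R^-1 *: \sum_i (- A i) - (- a)%:M.
  by rewrite sumrN scalerN aE opprK addrC.
apply: loewner_le_mean => // i; rewrite /loewner_le aE opprK addrC; exact: uA.
Qed.

End LoewnerMean.

(** * Sampling error *)

Section TupleSums.
Context {R : realType} {d n : nat}.
Implicit Types (p : 'I_n -> R) (X : 'I_n -> 'cV[R]_d).

Lemma big_tuple_cons (V : nmodType) (I : finType) T
    (P : pred (T.+1.-tuple I)) (g : T.+1.-tuple I -> V) :
  \sum_(t | P t) g t =
  \sum_(t : T.-tuple I) \sum_(x | P [tuple of x :: t]) g [tuple of x :: t].
Proof.
rewrite pair_big_dep /=.
rewrite (reindex (fun u : T.-tuple I * I => [tuple of u.2 :: u.1])) //=.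
exists (fun t : T.+1.-tuple I => ([tuple of behead t], thead t)).
  by move=> [t x] _ /=; congr (_, _); apply: val_inj.
by move=> t _; rewrite [RHS]tuple_eta.
Qed.

(** Induction on the number of draws: with the earlier draws fixed, a new one adds its own second
    moment, and the cross term 2 <E X, S t> vanishes because X is centered. *)
Lemma iid_moments p X T :
  \sum_i p i = 1 -> \sum_i p i *: X i = 0 ->
  let W (t : seq 'I_n) := \prod_(i <- t) p i in
  let S (t : seq 'I_n) := \sum_(i <- t) X i in
  [/\ \sum_(t : T.-tuple 'I_n) W t = 1, \sum_(t : T.-tuple 'I_n) W t *: S t = 0
    & \sum_(t : T.-tuple 'I_n) W t * dotp (S t) (S t) =
        T%:R * \sum_i p i * dotp (X i) (X i)].
Proof.
move=> p1 X0 W S; elim: T => [|T [W1 S0 V]].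
  have t0 (t : 0.-tuple 'I_n) : t = [tuple] by rewrite tuple0.
  rewrite /W /S; split.
  - by rewrite (big_pred1 [tuple]) ?big_nil // => t; apply/esym/eqP; exact: t0.
  - by rewrite big1 // => t _; rewrite (t0 t) !big_nil scaler0.
  - by rewrite mul0r big1 // => t _; rewrite (t0 t) !big_nil dotp0r mulr0.
have Wc x (t : T.-tuple 'I_n) : W (x :: t) = W t * p x.
  by rewrite /W big_cons mulrC.
have Sc x (t : T.-tuple 'I_n) : S (x :: t) = X x + S t.
  by rewrite /S big_cons.
split; rewrite big_tuple_cons.
- rewrite -[RHS]W1; apply: eq_bigr => t _; under eq_bigr do rewrite Wc.
  by rewrite -mulr_sumr p1 mulr1.
- rewrite -[RHS]S0; apply: eq_bigr => t _.
  under eq_bigr do rewrite Wc Sc -scalerA !scalerDr.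
  rewrite big_split /= -scaler_sumr X0 scaler0 add0r.
  by rewrite -scaler_sumr -scaler_suml p1 scale1r.
- rewrite mulrSr mulrDl -V mul1r.
  rewrite (eq_bigr (fun t : T.-tuple 'I_n => W t * (\sum_i p i * dotp (X i) (X i))
      + W t * dotp (S t) (S t))).
    by rewrite big_split /= -mulr_suml W1 mul1r addrC.
  move=> t _; rewrite -mulrDr.
  under eq_bigr do rewrite Wc Sc -mulrA.
  rewrite -mulr_sumr; congr (_ * _).
  transitivity (\sum_i p i * dotp (X i) (X i)
      + (2 * dotp (\sum_i p i *: X i) (S t)
         + (\sum_i p i) * dotp (S t) (S t))).
    rewrite dotp_suml mulr_sumr mulr_suml -!big_split /=.
    by apply: eq_bigr => i _; rewrite !dotpD (dotpC (S t) (X i)); ring.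
  by rewrite X0 dotp0l mulr0 add0r p1 mul1r.
Qed.

Lemma sum_notin_tuple (V : zmodType) T (t : T.-tuple 'I_n) (h : 'I_n -> V) :
  uniq t ->
  \sum_(x | x \notin t) h x = \sum_x h x - \sum_(x <- t) h x.
Proof.
by move=> ut; rewrite [in RHS](bigID (mem t)) /= big_uniq //= addrAC subrr add0r.
Qed.

(* Sampling without replacement: the draws are negatively correlated, so the
   second moment of the sum is at most the one of independent draws. *)
Lemma uniq_tuple_moments X T : (T <= n)%N -> \sum_i X i = 0 ->
  let S (t : seq 'I_n) := \sum_(i <- t) X i in
  let V := n%:R^-1 * \sum_i dotp (X i) (X i) in
  [/\ \sum_(t : T.-tuple 'I_n | uniq t) 1 = (n ^_ T)%:R :> R,
      \sum_(t : T.-tuple 'I_n | uniq t) \sum_(i <- t) dotp (X i) (X i) =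
        T%:R * V * (n ^_ T)%:R
    & \sum_(t : T.-tuple 'I_n | uniq t) dotp (S t) (S t) <=
        T%:R * V * (n ^_ T)%:R].
Proof.
move=> + X0 S V; elim: T => [|T IH] Tn.
  have t0 (t : 0.-tuple 'I_n) : t = [tuple] by rewrite tuple0.
  rewrite /S; split.
  - rewrite (big_pred1 [tuple]) ?ffactn0 // => t.
    by rewrite (t0 t) /= eqxx.
  - by rewrite !mul0r big1 // => t _; rewrite (t0 t) big_nil.
  - by rewrite !mul0r big1 // => t _; rewrite (t0 t) big_nil dotp0r.
have [N1 D1 U1] := IH (ltnW Tn).
have n0 : n%:R != 0 :> R by rewrite pnatr_eq0 -lt0n (leq_ltn_trans _ Tn).
have nV : \sum_i dotp (X i) (X i) = n%:R * V by rewrite /V mulrA divff ?mul1r.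
have V0 : 0 <= V.
  by rewrite mulr_ge0 ?invr_ge0 ?ler0n // sumr_ge0 // => i _; exact: dotp_ge0.
have nT : 0 <= n%:R - T%:R :> R by rewrite subr_ge0 ler_nat ltnW.
have NS : (n ^_ T.+1)%:R = (n%:R - T%:R) * (n ^_ T)%:R :> R.
  by rewrite ffactnSr natrM natrB ?(ltnW Tn) // mulrC.
have split_uniq (g : T.+1.-tuple 'I_n -> R) :
    \sum_(t : T.+1.-tuple 'I_n | uniq t) g t =
    \sum_(t : T.-tuple 'I_n | uniq t) \sum_(x | x \notin t) g [tuple of x :: t].
  rewrite big_tuple_cons [RHS]big_mkcond /=; apply: eq_bigr => t _.
  case ut : (uniq t); first by apply: eq_bigl => x; rewrite andbT.
  by rewrite big_pred0 // => x; rewrite andbF.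
have card_notin (t : T.-tuple 'I_n) : uniq t ->
    \sum_(x | x \notin t) (1 : R) = n%:R - T%:R.
  move=> ut; rewrite sum_notin_tuple // sumr_const card_ord.
  by rewrite big_const_seq count_predT size_tuple iter_addr_0.
split; rewrite split_uniq.
- rewrite (eq_bigr (fun=> (n%:R - T%:R) * 1)).
    by rewrite -mulr_sumr N1 NS.
  by move=> t ut; rewrite card_notin // mulr1.
- rewrite (eq_bigr (fun t : T.-tuple _ => n%:R * V * 1
      + (n%:R - T%:R - 1) * \sum_(i <- t) dotp (X i) (X i))).
    rewrite big_split /= -!mulr_sumr N1 D1 NS mulrSr; ring.
  move=> t ut; under eq_bigr do rewrite big_cons.
  rewrite big_split /= sum_notin_tuple // nV.
  rewrite -[X in _ + X = _](_ : \sum_(x | x \notin t)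
    1 * (\sum_(i <- t) dotp (X i) (X i)) = _); last first.
    by apply: eq_bigr => x _; rewrite mul1r.
  by rewrite -mulr_suml card_notin //; ring.
(* As all X sum to 0, the indices not yet drawn sum to - S t, so the cross term is -2 |S t|^2 and is
   dropped. The squares over the remaining indices are n V minus those over [t], whose total is the
   second conjunct. *)
- apply: (@le_trans _ _ (\sum_(t : T.-tuple 'I_n | uniq t) (n%:R * V * 1
      + (n%:R - T%:R) * dotp (S t) (S t)
      + (-1) * \sum_(i <- t) dotp (X i) (X i)))); last first.
    rewrite !big_split /= -!mulr_sumr N1 D1 NS mulrSr.
    have := ler_wpM2l nT U1; lra.
  apply: ler_sum => t ut; under eq_bigr do rewrite /S big_cons -/(S t).
  rewrite (eq_bigr (fun x => dotp (X x) (X x)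
    + (2 * dotp (X x) (S t) + 1 * dotp (S t) (S t)))); last first.
    by move=> x _; rewrite !dotpD (dotpC (S t)); ring.
  rewrite !big_split /= -mulr_sumr -mulr_suml card_notin // -dotp_suml.
  rewrite !sum_notin_tuple // X0 sub0r -/(S t) dotpNl nV.
  have := dotp_ge0 (S t); lra.
Qed.

End TupleSums.

Lemma trmx_sub_sym (V : zmodType) d (A B : 'M[V]_d) :
  A^T = A -> B^T = B -> (A - B)^T = A - B.
Proof. by move=> sA sB; rewrite raddfB /= sA sB. Qed.

Section SamplingError.
Context {R : realType} {d n : nat}.
Variable F : 'I_n -> 'cV[R]_d -> R.
Implicit Types (s : sampling R d n) (w e : 'cV[R]_d).

Lemma sample_prob_ge0 s T w (t : T.-tuple 'I_n) :
  admissible_sampling F s -> 0 <= sample_prob s w t.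
Proof.
case: s => [||pi] /= adm; first by rewrite prodr_ge0 // => j _; rewrite invr_ge0.
  by case: ifP.
by rewrite prodr_ge0 // => j _; have [] := adm w.
Qed.

(** The total mass is only bounded by 1: without replacement and with T > n there is no
    repetition-free tuple, and all weights are 0. *)
Lemma sample_moments s T w (X : 'I_n -> 'cV[R]_d) : (0 < n)%N ->
  admissible_sampling F s -> \sum_i index_prob s w i *: X i = 0 ->
  \sum_(t : T.-tuple 'I_n) sample_prob s w t <= 1 /\
  \sum_(t : T.-tuple 'I_n) sample_prob s w t *
     dotp (\sum_(i <- t) X i) (\sum_(i <- t) X i) <=
   T%:R * \sum_i index_prob s w i * dotp (X i) (X i).
Proof.
move=> n0 adm X0; have nR : n%:R != 0 :> R by rewrite pnatr_eq0 -lt0n.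
have iid p : \sum_i p i = 1 -> \sum_i p i *: X i = 0 ->
    \sum_(t : T.-tuple 'I_n) \prod_(j < T) p (tnth t j) <= 1 /\
    \sum_(t : T.-tuple 'I_n) \prod_(j < T) p (tnth t j) *
       dotp (\sum_(i <- t) X i) (\sum_(i <- t) X i) <=
     T%:R * \sum_i p i * dotp (X i) (X i).
  move=> p1 pX; have [W1 _ V1] := iid_moments T p1 pX.
  split.
    by rewrite -[leRHS]W1; apply: ler_sum => t _; rewrite [leRHS]big_tuple.
  rewrite -V1; apply: ler_sum => t _.
  by rewrite [X in _ <= X * _]big_tuple.
case: s adm X0 => [||pi] /= adm X0; [apply: iid => //| |apply: iid => //].
- by rewrite sumr_const card_ord -[LHS]mulr_natl divff.
- have {}X0 : \sum_i X i = 0.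
    move: X0; rewrite -scaler_sumr => /eqP; rewrite scaler_eq0 invr_eq0.
    by rewrite (negbTE nR) => /eqP.
  have [Tn|nT] := leqP T n; last first.
    rewrite ffact_small // invr0.
    split; first by rewrite big1 // => t _; case: ifP.
    rewrite big1 => [|t _]; last by case: ifP; rewrite mul0r.
    rewrite mulr_ge0 ?ler0n // sumr_ge0 // => i _.
    by rewrite mulr_ge0 ?dotp_ge0 ?invr_ge0.
  have [N1 _ U1] := uniq_tuple_moments Tn X0.
  have N0 : (n ^_ T)%:R != 0 :> R by rewrite pnatr_eq0 -lt0n ffact_gt0.
  split.
    rewrite -big_mkcond /= (eq_bigr (fun=> (n ^_ T)%:R^-1 * 1)).
      by rewrite -mulr_sumr N1 mulVf.
    by move=> t _; rewrite mulr1.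
  rewrite (eq_bigr (fun t : T.-tuple 'I_n => if uniq t then
     (n ^_ T)%:R^-1 * dotp (\sum_(i <- t) X i) (\sum_(i <- t) X i) else 0)).
    rewrite -big_mkcond /= -!mulr_sumr mulrC ler_pdivrMr //.
    by rewrite ltr0n ffact_gt0.
  by move=> t _; case: ifP; rewrite ?mul0r.
- by have [] := adm w.
Qed.

(* Jensen's inequality for the square root is replaced by
   y <= (y^2 / a + a) / 2. *)
Lemma sample_mean_error s T w (A : 'I_n -> 'M[R]_d) (H : 'M[R]_d) e
    (sigma a : R) : (0 < n)%N -> (0 < T)%N ->
  admissible_sampling F s ->
  (forall i, (A i)^T = A i) -> H^T = H ->
  \sum_i index_prob s w i = 1 -> \sum_i index_prob s w i *: A i = H ->
  opnorm (\sum_i index_prob s w i *: ((A i - H) *m (A i - H))) <= sigma ^+ 2 ->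
  0 < a -> sigma ^+ 2 <= a ^+ 2 * T%:R ->
  \sum_(t : T.-tuple 'I_n) sample_prob s w t *
    enorm ((T%:R^-1 *: (\sum_(j < T) A (tnth t j)) - H) *m e) <= a * enorm e.
Proof.
move=> n0 T0 adm symA symH p1 pA var a0 sa.
have TR : 0 < T%:R :> R by rewrite ltr0n.
pose X i := (A i - H) *m e.
have pX : \sum_i index_prob s w i *: X i = 0.
  have -> : \sum_i index_prob s w i *: X i =
      (\sum_i index_prob s w i *: A i
        - (\sum_i index_prob s w i) *: H) *m e.
    rewrite mulmxBl mulmx_suml scaler_suml mulmx_suml -sumrB.
    by apply: eq_bigr => i _; rewrite /X mulmxBl scalerBr -!scalemxAl.
  by rewrite pA p1 scale1r subrr mul0mx.
have [P1 P2] := sample_moments T n0 adm pX.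
have ssE (t : T.-tuple 'I_n) : (T%:R^-1 *: (\sum_(j < T) A (tnth t j)) - H) *m e =
    T%:R^-1 *: \sum_(i <- t) X i.
  have -> : \sum_(i <- t) X i =
      (\sum_(i <- t) A i - (size t)%:R *: H) *m e.
    elim: (tval t) => [|i r IH]; first by rewrite !big_nil scale0r subr0 mul0mx.
    rewrite !big_cons IH -mulmxDl /= mulrS scalerDl scale1r opprD.
    by rewrite addrACA.
  rewrite size_tuple scalemxAl scalerBr scalerA mulVf ?gt_eqF //.
  by rewrite scale1r big_tuple.
(* By symmetry of A_i - H, the left side is <e, E[(A_i - H)^2] e>, to which the bound on the
   operator norm applies. *)
have varX : \sum_i index_prob s w i * dotp (X i) (X i) <=
    sigma ^+ 2 * dotp e e.
  have -> : \sum_i index_prob s w i * dotp (X i) (X i) =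
      dotp e ((\sum_i index_prob s w i *:
        ((A i - H) *m (A i - H))) *m e).
    rewrite mulmx_suml dotp_sumr; apply: eq_bigr => i _.
    rewrite -scalemxAl dotpZr -mulmxA [in RHS]dotp_sym //.
    exact: trmx_sub_sym.
  apply: le_trans (cauchy_schwarz _ _) _.
  rewrite -enorm_sqr expr2 mulrCA ler_wpM2l ?enorm_ge0 //.
  apply: le_trans (enorm_mulmx _ _) _.
  by rewrite ler_wpM2r ?enorm_ge0.
have [->|e0] := eqVneq e 0.
  by rewrite enorm0 mulr0 big1 // => t _; rewrite mulmx0 enorm0 mulr0.
have {}e0 : 0 < enorm e by rewrite lt0r enorm_eq0 e0 enorm_ge0.
(* The inequality for the square root is used with the target bound [c] as its parameter; the
   quadratic and the constant part then contribute at most c / 2 each. *)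
set c := a * enorm e; have c0 : 0 < c by rewrite mulr_gt0.
apply: (@le_trans _ _ (\sum_(t : T.-tuple 'I_n)
   ((2 * c * T%:R ^+ 2)^-1 * (sample_prob s w t *
      dotp (\sum_(i <- t) X i) (\sum_(i <- t) X i))
    + c / 2 * sample_prob s w t))).
  apply: ler_sum => t _; rewrite ssE enormZ gtr0_norm ?invr_gt0 //.
  rewrite -enorm_sqr; set y := enorm _; set p := sample_prob _ _ _.
  have p0 : 0 <= p by exact: sample_prob_ge0.
  rewrite -subr_ge0.
  have -> : (2 * c * T%:R ^+ 2)^-1 * (p * y ^+ 2) + c / 2 * p -
     p * (T%:R^-1 * y) = p * ((y / T%:R - c) ^+ 2 / (2 * c)).
    by field; rewrite !gt_eqF.
  by rewrite mulr_ge0 // divr_ge0 ?sqr_ge0 // mulr_ge0 // ltW.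
rewrite big_split /= -!mulr_sumr.
have h1 := le_trans P2 (ler_wpM2l (ltW TR) varX).
have k0 : 0 <= (2 * c * T%:R ^+ 2)^-1.
  by rewrite invr_ge0 !mulr_ge0 // ltW.
have {}h1 := ler_wpM2l k0 h1.
have h2 : (2 * c * T%:R ^+ 2)^-1 * (T%:R * (sigma ^+ 2 * dotp e e)) <= c / 2.
  have -> : c / 2 = (2 * c * T%:R ^+ 2)^-1 *
      (T%:R * (a ^+ 2 * T%:R * dotp e e)).
    by rewrite -enorm_sqr /c; field; rewrite !gt_eqF.
  apply: ler_wpM2l => //; apply: ler_wpM2l; first exact: ltW.
  by apply: ler_wpM2r => //; exact: dotp_ge0.
have h3 : c / 2 * (\sum_(t : T.-tuple 'I_n) sample_prob s w t) <= c / 2.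
  by rewrite ler_piMr // divr_ge0 // ltW.
rewrite [leRHS]splitr; apply: lerD h3; exact: le_trans h1 h2.
Qed.

Lemma subsampling_error s T w e (sigma a : R) : (0 < n)%N -> (0 < T)%N ->
  (forall i z, differentiable (F i) z) ->
  (forall i z, differentiable (gradient (F i)) z) ->
  (forall i, (hessian (F i) w)^T = hessian (F i) w) ->
  admissible_sampling F s -> bounded_hessian_variance F s sigma ->
  0 < a -> sigma ^+ 2 <= a ^+ 2 * T%:R ->
  \sum_(t : T.-tuple 'I_n) sample_prob s w t *
    enorm ((subsampled_hessian F t w - hessian (average F) w) *m e) <=
  a * enorm e.
Proof.
move=> n0 T0 dF dgF symF adm var a0 sa.
have nR : n%:R != 0 :> R by rewrite pnatr_eq0 -lt0n.
have HE := hessian_average dF dgF w.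
apply: (sample_mean_error (sigma := sigma) _ n0 T0 adm symF) => //.
- rewrite HE linearZ /= linear_sum; congr (_ *: _).
  by apply: eq_bigr => i _ /=; rewrite symF.
- case: s adm {var} => [||pi] /= adm; last by have [] := adm w.
    by rewrite sumr_const card_ord -[LHS]mulr_natl divff.
  by rewrite sumr_const card_ord -[LHS]mulr_natl divff.
- case: s adm {var} => [||pi] /= adm; last by have [] := adm w.
    by rewrite HE scaler_sumr.
  by rewrite HE scaler_sumr.
Qed.

End SamplingError.

(** * Linear convergence *)

Section NewtonStep.
Context {R : realType} {d n : nat}.
Variables (F : 'I_n -> 'cV[R]_d.+1 -> R) (mu L M : R).
Hypotheses (n_gt0 : (0 < n)%N) (mu_gt0 : 0 < mu) (L_gt0 : 0 < L) (M_gt0 : 0 < M).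
Hypotheses (F_hess : bounded_hessian_eigenvalues F mu L)
  (F_lip : lipschitz_hessian F M).

Let dF i w : differentiable (F i) w.
Proof. by have [[]] := F_hess i. Qed.

Let dgF i w : differentiable (gradient (F i)) w.
Proof. by have [[]] := F_hess i. Qed.

(** The exact Newton step x satisfies mu |x| <= |grad F(w)| <= L |e|, so the CG error mu / (8 L) |x|
    is at most |e| / 8. The other two terms come from mu |e + x| <= |A (e + x)| = |A e - grad
    F(w)|. *)
Lemma inexact_newton_step T (t : T.-tuple 'I_n) (w wstar : 'cV[R]_d.+1) r :
  (0 < T)%N -> (forall z, average F wstar <= average F z) ->
  smallest_cg_steps (L / mu) (subsampled_hessian F t w) r ->
  enorm (w + 1 *: cg (subsampled_hessian F t w) (- gradient (average F) w) r
         - wstar) <=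
  mu^-1 * enorm ((subsampled_hessian F t w - hessian (average F) w)
                 *m (w - wstar))
  + M / (2 * mu) * enorm (w - wstar) ^+ 2 + 1 / 8 * enorm (w - wstar).
Proof.
move=> T0 minF [lam slam [r1 rate _]]; rewrite scale1r.
have lA : loewner_le mu%:M (subsampled_hessian F t w).
  by apply: loewner_le_mean => // j; have [_ /(_ w)[]] := F_hess (tnth t j).
have uA : loewner_le (subsampled_hessian F t w) L%:M.
  by apply: loewner_ge_mean => // j; have [_ /(_ w)[]] := F_hess (tnth t j).
have lH z : loewner_le mu%:M (hessian (average F) z).
  rewrite hessian_average //; apply: loewner_le_mean => // i.
  by have [_ /(_ z)[]] := F_hess i.
have uH z : loewner_le (hessian (average F) z) L%:M.
  rewrite hessian_average //; apply: loewner_ge_mean => // i.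
  by have [_ /(_ z)[]] := F_hess i.
have g0 : gradient (average F) wstar = 0.
  by apply: gradient_minimizer => // z; exact: differentiable_average.
have dg z : differentiable (gradient (average F)) z.
  exact: differentiable_gradient_average.
have gL := gradient_lipschitz w wstar (ltW mu_gt0) dg lH uH.
have gT := gradient_taylor w wstar (ltW M_gt0) dg F_lip.
move: gL gT; rewrite g0 subr0.
set g := gradient _ w; set H := hessian _ w; set e := w - wstar.
move: slam rate lA uA; set A := subsampled_hessian F t w => slam rate lA uA.
clearbody A H g => gL gT.
pose x := invmx A *m - g.
have Ax : A *m x = - g by rewrite mulKVmx ?(loewner_le_unit mu_gt0 lA).
have cgx := cg_error mu_gt0 L_gt0 lA uA slam r1 rate Ax.
have x_le : mu * enorm x <= L * enorm e.
  apply: le_trans gL; rewrite -(enormN g) -Ax; exact: enorm_loewner_inv.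
have ex_le : mu * enorm (e + x) <=
    enorm ((A - H) *m e) + M / 2 * enorm e ^+ 2.
  apply: le_trans (enorm_loewner_inv _ mu_gt0 lA) _.
  apply: le_trans _ (lerD (lexx _) gT); apply: le_trans _ (enormD _ _).
  by rewrite mulmxDr Ax mulmxBl addrA subrK.
have -> : w + cg A (- g) r - wstar = (e + x) + (cg A (- g) r - x).
  by rewrite addrACA subrr addr0 /e addrAC.
apply: le_trans (enormD _ _) _; apply: lerD.
  rewrite -(ler_pM2l mu_gt0); apply: le_trans ex_le _.
  by rewrite le_eqVlt (_ : _ == _) //; apply/eqP; field; rewrite gt_eqF.
apply: le_trans cgx _.
rewrite (_ : mu / (8 * L) * enorm x = (8 * L)^-1 * (mu * enorm x)); last by ring.
apply: le_trans (ler_wpM2l _ x_le) _; first by rewrite invr_ge0 mulr_ge0 ?ltW.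
by rewrite le_eqVlt (_ : _ == _) //; apply/eqP; field; rewrite gt_eqF.
Qed.

End NewtonStep.

(** * Expectations of random variables with finitely many values *)

Section FiniteExpectation.
Context {R : realType} {dO : measure_display} {Omega : measurableType dO}.
Variable P : probability Omega R.

Lemma measurable_finite_comp (I : finType) (X : Omega -> I) (g : I -> \bar R) :
  (forall i, measurable (X @^-1` [set i])) ->
  measurable_fun setT (fun omega => g (X omega)).
Proof.
move=> mX _ B _; rewrite setTI.
have -> : (fun omega => g (X omega)) @^-1` B =
    \bigcup_(i in [set i | B (g i)]) (X @^-1` [set i]).
  apply/seteqP; split=> [omega Bo|omega [i Bi] /= Xi]; first by exists (X omega).
  by rewrite Xi.
by apply: fin_bigcup_measurable => // i _; exact: mX.
Qed.

Lemma expectation_finite (I : finType) (X : Omega -> I) (g : I -> R) :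
  (forall i, measurable (X @^-1` [set i])) -> (forall i, 0 <= g i) ->
  'E_P[fun omega => g (X omega)]%E =
  (\sum_i g i * fine (P (X @^-1` [set i])))%:E.
Proof.
move=> mX g0; rewrite unlock.
under eq_integral => omega _.
  rewrite (_ : (g (X omega))%:E =
    (\sum_i (g i)%:E * (\1_(X @^-1` [set i]) omega)%:E)%E); last first.
    rewrite (bigD1 (X omega)) //= big1 ?adde0 => [|i iX].
      by rewrite indicE mem_set // mule1.
    by rewrite indicE memNset ?mule0 // => /= Xi; rewrite Xi eqxx in iX.
  over.
have m1 i : measurable_fun setT (fun omega => (\1_(X @^-1` [set i]) omega : R)%:E).
  apply/measurable_EFinP; exact: measurable_indic.
rewrite ge0_integral_sum //; first last.
- by move=> i omega _; rewrite mule_ge0 ?lee_fin.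
- by move=> i; exact: measurable_funeM.
rewrite -sumEFin; apply: eq_bigr => i _.
rewrite (ge0_integralZl_EFin P measurableT _ (m1 i) (g0 i)); last first.
  by move=> omega _; rewrite lee_fin.
by rewrite integral_indic // setIT EFinM fineK // fin_num_measure.
Qed.

(** The comparison passes through [Omega] because the two sides are indexed differently: the new
    error by a history of length k + 1, its bound by a pair of a history of length k and a
    sample. *)
Lemma expectation_finite_le (I J : finType) (X : Omega -> I) (Y : Omega -> J)
    (f : I -> R) (g : J -> R) :
  (forall i, measurable (X @^-1` [set i])) ->
  (forall j, measurable (Y @^-1` [set j])) ->
  (forall i, 0 <= f i) -> (forall j, 0 <= g j) ->
  (forall omega, f (X omega) <= g (Y omega)) ->
  \sum_i f i * fine (P (X @^-1` [set i])) <=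
  \sum_j g j * fine (P (Y @^-1` [set j])).
Proof.
move=> mX mY f0 g0 fg; rewrite -lee_fin -!expectation_finite // unlock.
apply: ge0_le_integral => //.
- by move=> omega _; rewrite lee_fin.
- exact: (measurable_finite_comp (EFin \o f) mX).
- exact: (measurable_finite_comp (EFin \o g) mY).
- by move=> omega _; rewrite lee_fin.
Qed.

End FiniteExpectation.

Lemma sample_prob_sum_le1 {R : realType} {d n : nat}
    (F : 'I_n -> 'cV[R]_d -> R) s T w : (0 < n)%N ->
  admissible_sampling F s ->
  \sum_(t : T.-tuple 'I_n) sample_prob s w t <= 1.
Proof.
move=> n0 adm; have X0 : \sum_i index_prob s w i *: (0 : 'cV[R]_d) = 0.
  by rewrite big1 // => i _; rewrite scaler0.
by have [] := sample_moments T n0 adm X0.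
Qed.

Section LinearConvergence.
Context {R : realType} {d n : nat}.
Context {dO : measure_display} {Omega : measurableType dO}.
Variables (P : probability Omega R) (F : 'I_n -> 'cV[R]_d.+1 -> R).
Variables (wstar w0 : 'cV[R]_d.+1) (mu L M gamma sigma : R) (T : nat).
Variables (s : sampling R d.+1 n) (Tk : nat -> Omega -> T.-tuple 'I_n).
Variables (r : nat -> Omega -> nat) (w : nat -> Omega -> 'cV[R]_d.+1).
Hypotheses (n_gt0 : (0 < n)%N) (T_gt0 : (0 < T)%N).
Hypotheses (mu_gt0 : 0 < mu) (L_gt0 : 0 < L) (M_gt0 : 0 < M)
  (gamma_gt0 : 0 < gamma).
Hypotheses (minF : forall z, average F wstar <= average F z)
  (adm : admissible_sampling F s)
  (F_hess : bounded_hessian_eigenvalues F mu L)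
  (F_lip : lipschitz_hessian F M)
  (F_var : bounded_hessian_variance F s sigma)
  (moments : bounded_moments P w wstar gamma)
  (run : ssn_cg P F s (fun _ => 1) w0 Tk r w)
  (w0_close : enorm (w0 - wstar) <= mu / (2 * gamma * M))
  (T_large : 64 * sigma ^+ 2 / mu ^+ 2 <= T%:R)
  (r_min : forall k omega, smallest_cg_steps (L / mu)
     (subsampled_hessian F (Tk k omega) (w k omega)) (r k omega)).

Definition sample_history k (omega : Omega) : {ffun 'I_k -> T.-tuple 'I_n} :=
  [ffun j : 'I_k => Tk j omega].

Lemma sample_historyP k omega omega' :
  sample_history k omega = sample_history k omega' <->
  forall j, (j < k)%N -> Tk j omega = Tk j omega'.
Proof.
split=> [/ffunP H j jk|H]; first by have := H (Ordinal jk); rewrite !ffunE.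
by apply/ffunP => j; rewrite !ffunE H.
Qed.

Lemma measurable_sample_history k h :
  measurable (sample_history k @^-1` [set h]).
Proof.
have -> : sample_history k @^-1` [set h] =
    \big[setI/setT]_(j < k) (Tk j @^-1` [set h j]).
  rewrite -bigcap_seq; apply/seteqP; split=> [omega /= <- j _|omega H /=].
    by rewrite /= ffunE.
  by apply/ffunP => j; rewrite ffunE; apply: H; rewrite /= mem_index_enum.
by apply: bigsetI_measurable => j _; exact: ssn_cg_measurable run _ _.
Qed.

(** [r] is given only as some function obeying the step rule; this makes r_k, and hence w_{k+1},
    depend on nothing but T_k and w_k. *)
Lemma smallest_cg_steps_unique (kappa : R) (A : 'M[R]_d.+1) q q' :
  smallest_cg_steps kappa A q -> smallest_cg_steps kappa A q' -> q = q'.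
Proof.
move=> [lam slam [q1 ok mq]] [lam' slam' [q1' ok' mq']].
have E := spectrum_unique slam slam'; subst lam'.
by apply/eqP; rewrite eqn_leq mq // mq'.
Qed.

Lemma iterate_of_history k omega omega' :
  sample_history k omega = sample_history k omega' -> w k omega = w k omega'.
Proof.
move=> /sample_historyP; elim: k => [|k IH] H; first by rewrite !(ssn_cg_init run).
have wk : w k omega = w k omega' by apply: IH => j jk; apply/H/ltnW.
have Tkk := H k (ltnSn k).
rewrite !(ssn_cg_iterate run) Tkk wk; congr (_ + _ *: cg _ _ _).
apply: smallest_cg_steps_unique (r_min k omega').
by rewrite -Tkk -wk.
Qed.

(* w_k as a function of the history; wstar is a junk value. *)
Definition iterate_at k (h : {ffun 'I_k -> T.-tuple 'I_n}) : 'cV[R]_d.+1 :=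
  match pselect (exists omega, sample_history k omega = h) with
  | left e => w k (projT1 (cid e))
  | right _ => wstar
  end.

Lemma iterate_atE k omega : w k omega = iterate_at (sample_history k omega).
Proof.
rewrite /iterate_at; case: pselect => [e|[]]; last by exists omega.
by case: cid => omega' /= H; apply: iterate_of_history.
Qed.

Lemma history_sample_prob k h t :
  fine (P ((fun omega => (sample_history k omega, Tk k omega)) @^-1` [set (h, t)]))
  = sample_prob s (iterate_at h) t * fine (P (sample_history k @^-1` [set h])).
Proof.
have -> : (fun omega => (sample_history k omega, Tk k omega)) @^-1` [set (h, t)]
    = (sample_history k @^-1` [set h]) `&` (Tk k @^-1` [set t]).
  by apply/seteqP; split=> omega /=; [case=> -> ->|case=> -> ->].
have [[omega0 h0]|nh] := pselect (exists omega, sample_history k omega = h).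
  have := ssn_cg_law run k t omega0 => /=.
  have -> : [set omega | forall j, (j < k)%N -> Tk j omega = Tk j omega0] =
      sample_history k @^-1` [set h].
    by rewrite -h0; apply/seteqP; split=> omega /=; rewrite sample_historyP.
  by rewrite iterate_atE h0 => ->; rewrite fineM ?fin_num_measure //;
    exact: measurable_sample_history.
(* The law of the method speaks of attained histories only; for the others both sides vanish,
   whatever the junk value of [iterate_at]. *)
have -> : sample_history k @^-1` [set h] = set0.
  by apply/seteqP; split=> // omega /= H; apply: nh; exists omega.
by rewrite set0I measure0 mulr0.
Qed.

Definition mean_error k : R :=
  \sum_h enorm (@iterate_at k h - wstar) * fine (P (sample_history k @^-1` [set h])).

Lemma expected_errorE k : expected_error P w wstar k = (mean_error k)%:E.
Proof.
rewrite /expected_error.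
under [X in expectation _ X]funext => omega do rewrite iterate_atE.
apply: (expectation_finite P (X := sample_history k)
  (g := fun h => enorm (@iterate_at k h - wstar))).
- exact: measurable_sample_history.
- by move=> h; exact: enorm_ge0.
Qed.

Lemma mean_sqr_error k :
  \sum_h enorm (@iterate_at k h - wstar) ^+ 2 *
    fine (P (sample_history k @^-1` [set h])) <= gamma * mean_error k ^+ 2.
Proof.
have := moments k; rewrite expected_errorE.
under [X in expectation _ X]funext => omega do rewrite iterate_atE.
rewrite (expectation_finite P (X := sample_history k)
  (g := fun h => enorm (@iterate_at k h - wstar) ^+ 2)) ?lee_fin //.
- exact: measurable_sample_history.
- by move=> h; exact: sqr_ge0.
Qed.

Lemma mean_error_step k : mean_error k.+1 <=
  1 / 4 * mean_error k + M * gamma / (2 * mu) * mean_error k ^+ 2.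
Proof.
have dF i z : differentiable (F i) z by have [[]] := F_hess i.
have dgF i z : differentiable (gradient (F i)) z by have [[]] := F_hess i.
have symF i z : (hessian (F i) z)^T = hessian (F i) z.
  by have [_ /(_ z)[/loewner_le_scalar_sym]] := F_hess i.
pose p h := fine (P (sample_history k @^-1` [set h])).
have p0 h : 0 <= p h by apply: fine_ge0; exact: measure_ge0.
pose e (h : {ffun 'I_k -> T.-tuple 'I_n}) := enorm (iterate_at h - wstar).
have e0 h : 0 <= e h by exact: enorm_ge0.
pose y (h : {ffun 'I_k -> T.-tuple 'I_n}) (t : T.-tuple 'I_n) :=
  enorm ((subsampled_hessian F t (iterate_at h)
    - hessian (average F) (iterate_at h)) *m (iterate_at h - wstar)).
have y0 h t : 0 <= y h t by exact: enorm_ge0.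
(* The part of the one-step bound that does not involve the new sample. *)
pose q h := M / (2 * mu) * e h ^+ 2 + 1 / 8 * e h.
have q0 h : 0 <= q h.
  by rewrite addr_ge0 // mulr_ge0 ?divr_ge0 ?sqr_ge0 // ?mulr_ge0 // ltW.
pose g (ht : {ffun 'I_k -> T.-tuple 'I_n} * T.-tuple 'I_n) :=
  mu^-1 * y ht.1 ht.2 + q ht.1.
have step : mean_error k.+1 <= \sum_ht g ht *
    fine (P ((fun omega => (sample_history k omega, Tk k omega)) @^-1` [set ht])).
  apply: expectation_finite_le.
  - exact: measurable_sample_history.
  - case=> h t; rewrite (_ : _ @^-1` _ =
        (sample_history k @^-1` [set h]) `&` (Tk k @^-1` [set t])).
      by apply: measurableI; [exact: measurable_sample_history|
        exact: ssn_cg_measurable run _ _].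
    by apply/seteqP; split=> omega /=; [case=> -> ->|case=> -> ->].
  - by move=> h; exact: enorm_ge0.
  - by case=> h t; rewrite /g addr_ge0 // mulr_ge0 // invr_ge0 ltW.
  - move=> omega; rewrite -iterate_atE (ssn_cg_iterate run).
    rewrite /g /y /q /e /= -iterate_atE addrA.
    exact: (inexact_newton_step n_gt0 mu_gt0 L_gt0 M_gt0 F_hess F_lip).
apply: le_trans step _.
have -> : \sum_ht g ht *
    fine (P ((fun omega => (sample_history k omega, Tk k omega)) @^-1` [set ht])) =
  \sum_h \sum_t g (h, t) * (sample_prob s (iterate_at h) t * p h).
  rewrite pair_big; apply: eq_bigr => -[h t] _ /=.
  by rewrite history_sample_prob.
apply: (@le_trans _ _ (\sum_h (1 / 8 * e h + q h) * p h)).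
  apply: ler_sum => h _.
  have -> : \sum_t g (h, t) * (sample_prob s (iterate_at h) t * p h) =
      (mu^-1 * (\sum_t sample_prob s (iterate_at h) t * y h t) +
       q h * \sum_(t : T.-tuple 'I_n) sample_prob s (iterate_at h) t) * p h.
    rewrite !mulr_sumr -big_split /= mulr_suml; apply: eq_bigr => t _.
    by rewrite /g /=; ring.
  apply: ler_wpM2r => //; apply: lerD; last first.
    by apply: ler_piMr => //; exact: sample_prob_sum_le1 adm.
  (* The sampling bound is taken with [a = mu / 8]; its requirement sigma^2 <= (mu / 8)^2 T is the
     origin of the 64 in the sample size. *)
  rewrite ler_pdivrMl // mulrA mulrA mulr1.
  apply: (@subsampling_error R d.+1 n F s T _ _ sigma) => //; first by rewrite divr_gt0.
  move: T_large; rewrite ler_pdivrMr ?exprn_gt0 // exprMn exprVn; lra.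
have -> : \sum_h (1 / 8 * e h + q h) * p h =
    1 / 4 * mean_error k + M / (2 * mu) * \sum_h e h ^+ 2 * p h.
  rewrite /mean_error !mulr_sumr -big_split /=; apply: eq_bigr => h _.
  by rewrite /q -/(e h) -/(p h); lra.
rewrite lerD2l (_ : M * gamma / (2 * mu) * mean_error k ^+ 2 =
    M / (2 * mu) * (gamma * mean_error k ^+ 2)); last by ring.
apply: ler_wpM2l; first by rewrite divr_ge0 ?mulr_ge0 // ltW.
exact: mean_sqr_error.
Qed.

Lemma mean_error_ge0 k : 0 <= mean_error k.
Proof.
apply: sumr_ge0 => h _; rewrite mulr_ge0 ?enorm_ge0 //.
by apply: fine_ge0; exact: measure_ge0.
Qed.

Lemma mean_error0 : mean_error 0 = enorm (w0 - wstar).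
Proof.
have := expected_errorE 0; rewrite /expected_error.
under [X in expectation _ X]funext => omega do rewrite (ssn_cg_init run).
by rewrite expectation_cst => -[].
Qed.

Lemma ssn_cg_linear_convergence k :
  mean_error k <= (1 / 2) ^+ k * enorm (w0 - wstar).
Proof.
elim: k => [|k IH]; first by rewrite expr0 mul1r mean_error0.
have E0 := mean_error_ge0 k.
have Ek : mean_error k <= mu / (2 * gamma * M).
  apply: le_trans IH _; apply: le_trans _ w0_close.
  by rewrite ler_piMl ?enorm_ge0 // exprn_ile1 //; lra.
rewrite exprS -[leRHS]mulrA; apply: le_trans (mean_error_step k) _.
have half0 : 0 <= 1 / 2 :> R by lra.
apply: le_trans _ (ler_wpM2l half0 IH).
(* At the radius mu / (2 gamma M), which the induction hypothesis preserves, the quadratic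
   coefficient M gamma / (2 mu) becomes exactly 1/4. *)
have -> : 1 / 2 * mean_error k = 1 / 4 * mean_error k
    + M * gamma / (2 * mu) * (mu / (2 * gamma * M)) * mean_error k.
  by field; rewrite !gt_eqF.
rewrite lerD2l expr2 mulrA ler_wpM2r // ler_wpM2l //.
by rewrite divr_ge0 ?mulr_ge0 // ltW.
Qed.

End LinearConvergence.

(** * Complexity *)

Lemma total_work_le n d T (r : nat -> nat) m K :
  (forall k, (r k <= m)%N) -> (total_work n d T r K <= K * ((n + m * T) * d))%N.
Proof.
move=> rm; apply: (@leq_trans (\sum_(k < K) (n + m * T) * d)%N).
  by apply: leq_sum => k _; rewrite leq_mul2r leq_add2l leq_mul2r rm !orbT.
by rewrite sum_nat_const card_ord.
Qed.

(* With K the integer part of x = 2 ln (1 / eps) / ln 2, one has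
   2^-K <= 2 * 2^-x = 2 eps^2, and a * 2 eps^2 <= eps for small eps. *)
Lemma halving_steps {R : realType} (a : R) : 0 <= a ->
  \forall eps \near (0 : R)^'+, 0 < eps /\ exists2 K : nat,
    (1 / 2) ^+ K * a <= eps & K%:R <= 2 / ln 2 * ln (1 / eps).
Proof.
move=> a0.
have ln2 : 0 < ln 2 :> R by rewrite ln_gt0 // ltr1n.
(* The smallness threshold for [eps]; [a + 1] keeps the denominator positive when [a = 0]. *)
have b0 : 0 < (2 * (a + 1))^-1 by rewrite invr_gt0 mulr_gt0 // ltr_wpDl.
near=> eps.
have eps0 : 0 < eps by near: eps; exact: nbhs_right_gt.
have epsa : eps < (2 * (a + 1))^-1 by near: eps; exact: nbhs_right_lt.
have eps1 : eps < 1 by near: eps; exact: nbhs_right_lt.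
(* Twice the base-2 logarithm: the second factor of [eps] absorbs the initial error [a], so the
   constant 2 / ln 2 does not depend on it. *)
split=> //; set x := 2 / ln 2 * ln (1 / eps).
have lneps : ln (1 / eps) = - ln eps by rewrite div1r lnV.
have x0 : 0 <= x.
  rewrite mulr_ge0 ?divr_ge0 ?(ltW ln2) // ln_ge0 // div1r.
  by rewrite invf_ge1 // ltW.
exists (Num.trunc x); last by rewrite truncn_le.
have /andP[_ xK] := truncn_itv x0; set K := Num.trunc x in xK *.
have halfK : (1 / 2) ^+ K <= 2 * eps ^+ 2.
  have halfE : 1 / 2 = expR (- ln 2) :> R by rewrite expRN lnK ?posrE // div1r.
  have -> : 2 * eps ^+ 2 = expR (ln 2 - x * ln 2).
    have -> : x * ln 2 = 2%:R * - ln eps by rewrite /x lneps; field; rewrite gt_eqF.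
    rewrite expRD lnK ?posrE // -mulrN opprK expRM_natl lnK ?posrE //.
  rewrite halfE -expRM_natl ler_expR.
  have := ler_wpM2r (ltW ln2) (ltW xK); rewrite -addn1 natrD; lra.
apply: le_trans (ler_wpM2r a0 halfK) _.
have : eps * (2 * (a + 1)) <= 1.
  by rewrite -ler_pdivlMr ?div1r ?ltW // mulr_gt0 // ltr_wpDl.
have := mulr_gt0 eps0 eps0; nra.
Unshelve. all: by end_near. Qed.

(* The hidden constant C' of the O(.), as epsilon tends to 0, exists for every
   T >= 64 sigma^2/mu^2. As long as T <= c sigma^2/mu^2, it is bounded by a C
   that depends on c only, not on the problem, the method or the run. *)
Theorem corollary5p2 (R : realType) (c : R) :
  exists2 C : R, 0 < C &
  forall (n d : nat) (F : 'I_n -> 'cV[R]_d -> R) (wstar : 'cV[R]_d)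
    (mu L M gamma sigma : R) (T : nat) (s : sampling R d n)
    (dO : measure_display) (Omega : measurableType dO)
    (P : probability Omega R) (w0 : 'cV[R]_d)
    (Tk : nat -> Omega -> T.-tuple 'I_n) (r : nat -> Omega -> nat)
    (w : nat -> Omega -> 'cV[R]_d) (rbar : Omega -> nat),
  (0 < n)%N -> (0 < d)%N -> (0 < T)%N ->
  0 < mu -> 0 < L -> 0 < M -> 0 < gamma ->
  (forall i, convex_on_space (F i)) ->
  (forall z, average F wstar <= average F z) ->
  admissible_sampling F s ->
  bounded_hessian_eigenvalues F mu L ->
  lipschitz_hessian F M ->
  bounded_hessian_variance F s sigma ->
  bounded_moments P w wstar gamma ->
  ssn_cg P F s (fun _ => 1) w0 Tk r w ->
  enorm (w0 - wstar) <= Num.min (mu / (2 * M)) (mu / (2 * gamma * M)) ->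
  64 * sigma ^+ 2 / mu ^+ 2 <= T%:R ->
  (forall k omega, smallest_cg_steps (L / mu)
     (subsampled_hessian F (Tk k omega) (w k omega)) (r k omega)) ->
  (forall omega, is_max (r ^~ omega) (rbar omega)) ->
  exists2 C' : R, (T%:R <= c * (sigma ^+ 2 / mu ^+ 2) -> C' <= C) &
  \forall eps \near (0 : R)^'+,
  exists2 K : nat, (expected_error P w wstar K <= eps%:E)%E &
    forall omega,
      (total_work n d T (r ^~ omega) K)%:R
        <= C' * ((n%:R + (rbar omega)%:R * (sigma ^+ 2 / mu ^+ 2))
                 * d%:R * ln (1 / eps)).
Proof.
have ln2 : 0 < ln 2 :> R by rewrite ln_gt0 // ltr1n.
have k0 : 0 < 2 / ln 2 :> R by rewrite divr_gt0.
have m0 : 0 < Num.max 1 c by rewrite lt_max ltr01.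
(* 2 / ln 2 counts the iterations per unit of ln (1 / eps); in the maximum, 1 serves the gradient
   cost n and [c] the replacement of T by sigma^2 / mu^2. *)
exists (2 / ln 2 * Num.max 1 c); first exact: mulr_gt0.
move=> n [//|d] F wstar mu L M gamma sigma T s dO Omega P w0 Tk r w rbar.
move=> n0 _ T0 mu0 L0 M0 gamma0 _ minF adm F_hess F_lip F_var moments run.
rewrite le_min => /andP[_ w0_close] T_large r_min r_max.
set v := sigma ^+ 2 / mu ^+ 2.
have v0 : 0 <= v by rewrite divr_ge0 ?sqr_ge0.
have rbar_le omega : (rbar omega <= d.+1)%N.
  by have [_ [k <-]] := r_max omega; exact: ssn_cg_steps_le run k omega.
have [D [D0 DC DE]] : exists D : R, [/\ 0 <= D,
    (T%:R <= c * v -> D <= Num.max 1 c)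
    & forall omega, n%:R + (rbar omega)%:R * T%:R <=
        D * (n%:R + (rbar omega)%:R * v)].
  have [Tc|Tc] := leP T%:R (c * v).
    exists (Num.max 1 c); split=> // [|omega]; first exact: ltW.
    rewrite mulrDr; apply: lerD; first by rewrite ler_peMl ?le_max ?lexx.
    rewrite mulrCA ler_wpM2l // (le_trans Tc) // ler_wpM2r // le_max lexx.
    by rewrite orbT.
  (* Here sigma^2 / mu^2 may be 0, so the Hessian-vector cost is charged to the gradient cost: rbar
     T <= d T <= d T n. Using rbar <= d makes the constant the same for all [omega]. *)
  exists (1 + d.+1%:R * T%:R); split=> [||omega].
  - by rewrite addr_ge0 ?mulr_ge0.
  - by [].
  - have h1 : (rbar omega)%:R * T%:R <= d.+1%:R * T%:R :> R.
      by rewrite ler_wpM2r // ler_nat.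
    have h2 : 1 <= n%:R :> R by rewrite ler1n.
    have h3 : 0 <= (rbar omega)%:R * v by rewrite mulr_ge0.
    have h4 : 0 <= d.+1%:R * T%:R :> R by rewrite mulr_ge0.
    nra.
exists (2 / ln 2 * D) => [Tc|]; first by rewrite ler_pM2l // DC.
near=> eps.
have [eps0 [K Ka Kx]] : 0 < eps /\ exists2 K : nat,
    (1 / 2) ^+ K * enorm (w0 - wstar) <= eps & K%:R <= 2 / ln 2 * ln (1 / eps).
  by near: eps; apply: halving_steps; exact: enorm_ge0.
exists K.
  rewrite (expected_errorE wstar run r_min) lee_fin; apply: le_trans Ka.
  exact: (ssn_cg_linear_convergence n0 T0 mu0 L0 M0 gamma0 minF adm F_hess F_lip
    F_var moments run w0_close T_large r_min).
move=> omega; have [rm _] := r_max omega.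
have := total_work_le n d.+1 T K rm; rewrite -(ler_nat R) => W.
apply: le_trans W _; rewrite !natrM natrD natrM.
set Q := n%:R + _ * v; set l := ln (1 / eps) in Kx *.
have DQ := DE omega; rewrite -/Q in DQ.
have Q0 : 0 <= n%:R + (rbar omega)%:R * T%:R :> R by rewrite addr_ge0 ?mulr_ge0.
rewrite (_ : 2 / ln 2 * D * (Q * d.+1%:R * l) =
  (2 / ln 2 * l) * (D * Q * d.+1%:R)); last by ring.
apply: ler_pM => //.
by rewrite ler_wpM2r.
Unshelve. all: by end_near. Qed.
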